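(* The set $$\{L(x,y)\mid (x,y)\in\mathcal S_{-1}\}$$ is the set of all irreducible $\mathcal W_{-1}$-modules in the category $\mathcal O$, where $\mathcal S_{-1}=\{(x,y)\in\mathbb C^2\mid h_1(x,y)=0\}$ with $h_1(x,y)=-3x^2+x+2y$.
   Context: For $k\in\mathbb C$, $k\ne -3$, $\mathcal W^k=\mathcal W^k(sl_3,f_\theta)$ is the universal Bershadsky-Polyakov vertex algebra of level $k$: the universal vertex algebra strongly generated by even fields $J,T,G^+,G^-$ with OPEs $J(z)J(w)\sim \frac{2k+3}{3}(z-w)^{-2}$, $G^\pm(z)G^\pm(w)\sim 0$, $J(z)G^\pm(w)\sim \pm G^\pm(w)(z-w)^{-1}$, $T(z)T(w)\sim \frac{c_k}{2}(z-w)^{-4}+2T(w)(z-w)^{-2}+DT(w)(z-w)^{-1}$, $T(z)G^\pm(w)\sim\frac32 G^\pm(w)(z-w)^{-2}+DG^\pm(w)(z-w)^{-1}$, $T(z)J(w)\sim J(w)(z-w)^{-2}+DJ(w)(z-w)^{-1}$, $G^+(z)G^-(w)\sim (k+1)(2k+3)(z-w)^{-3}+3(k+1)J(w)(z-w)^{-2}+\left(3:J(w)J(w):+\frac{3(k+1)}{2}DJ(w)-(k+3)T(w)\right)(z-w)^{-1}$, where $c_k=-\frac{(3k+1)(2k+3)}{k+3}$ and $D$ is the translation operator (derivative). $\mathcal W_k$ is its unique simple quotient. Modes: $T(z)=\sum L_nz^{-n-2}$, $J(z)=\sum J_nz^{-n-1}$, $G^\pm(z)=\sum G^\pm_nz^{-n-1}$.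 Set $J(n)=J_n$, $L(n)=L_n-\frac{n+1}{2}J_n$, $G^+(n)=G^+_n$, $G^-(n)=G^-_{n+1}$; the $L(n)$ are the modes of the conformal vector $\overline\omega=\omega+\frac12 DJ$, where $\omega$ is the conformal vector of $T$. For $(x,y)\in\mathbb C^2$, $L(x,y)$ is the irreducible $\mathcal W^k$-module generated by a highest weight vector $v(x,y)$ with $J(0)v(x,y)=xv(x,y)$, $L(0)v(x,y)=yv(x,y)$, and $J(n)v(x,y)=L(n)v(x,y)=G^+(n)v(x,y)=G^-(n-1)v(x,y)=0$ for $n\ge1$. $L(x,y)$ is a $\mathcal W_k$-module if the action of $\mathcal W^k$ factors through $\mathcal W_k$. The irreducible $\mathcal W_k$-modules in the category $\mathcal O$ are the irreducible highest weight modules, i.e. those $L(x,y)$, $(x,y)\in\mathbb C^2$, which are $\mathcal W_k$-modules. *)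

(* Defs.v *)
From HB Require Import structures.
From mathcomp Require Import all_boot all_order all_algebra.
From mathcomp Require Import reals.
From mathcomp.real_closed Require Export complex.

Set Implicit Arguments.
Unset Strict Implicit.
Unset Printing Implicit Defensive.

Import Order.TTheory GRing.Theory Num.Theory.
Local Open Scope ring_scope.

Section VertexAlgebras.

Variable C : numFieldType.

Definition binz (m : int) (i : nat) : C :=
  (\prod_(j < i) (m - (j : nat)%:Z)%:~R) / (i`!)%:R.

(* [act a n w] is the n-th mode a_(n) w, where Y(a,z) = sum_n a_(n) z^(-n-1). *)

Definition bilinear_modes (V M : lmodType C) (act : V -> int -> M -> M) : Prop :=
  (forall (n : int) (w : M) (c : C) (a b : V),
     act (c *: a + b) n w = c *: act a n w + act b n w) /\
  (forall (a : V) (n : int) (c : C) (u w : M),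
     act a n (c *: u + w) = c *: act a n u + act a n w).

Definition truncated_modes (V M : lmodType C) (act : V -> int -> M -> M) : Prop :=
  forall (a : V) (w : M), exists N : int, forall n : int, N <= n -> act a n w = 0.

(* The Borcherds (Jacobi) identity.  By truncation both series have finitely
   many nonzero terms, so the identity is the equality of all sufficiently
   long partial sums. *)
Definition borcherds (V M : lmodType C)
    (prod : V -> int -> V -> V) (act : V -> int -> M -> M) : Prop :=
  forall (a b : V) (m n k : int) (w : M),
  exists N0 : nat, forall N : nat, (N0 <= N)%N ->
    \sum_(j < N) binz m j *:
        act (prod a (n + j%:Z) b) (m + k - j%:Z) w
    = \sum_(j < N) ((-1) ^+ j * binz n j) *:
        (act a (m + n - j%:Z) (act b (k + j%:Z) w)
         - (-1) ^ n *: act b (n + k - j%:Z) (act a (m + j%:Z) w)).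

Record vertexAlgebra := VertexAlgebra {
  va_sort :> lmodType C;
  vac : va_sort;
  nprod : va_sort -> int -> va_sort -> va_sort;
  nprod_bilinear : bilinear_modes nprod;
  nprod_truncated : truncated_modes nprod;
  nprod_vacl : forall (n : int) (a : va_sort),
    nprod vac n a = if n == -1 then a else 0;
  nprod_vacr : forall a : va_sort, nprod a (-1) vac = a;
  nprod_vacr0 : forall (n : nat) (a : va_sort), nprod a n%:Z vac = 0;
  nprod_borcherds : borcherds nprod nprod
}.

Definition transl (V : vertexAlgebra) (a : V) : V := nprod a (-2) (vac V).

Record vaModule (V : vertexAlgebra) := VaModule {
  mod_sort :> lmodType C;
  mact : V -> int -> mod_sort -> mod_sort;
  mact_bilinear : bilinear_modes mact;
  mact_truncated : truncated_modes mact;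
  mact_vac : forall (n : int) (w : mod_sort),
    mact (vac V) n w = if n == -1 then w else 0;
  mact_borcherds : borcherds (@nprod V) mact
}.

Definition subspace (U : lmodType C) (P : U -> Prop) : Prop :=
  P 0 /\ forall (c : C) (u v : U), P u -> P v -> P (c *: u + v).

Definition va_hom (V V' : vertexAlgebra) (f : V -> V') : Prop :=
  [/\ forall (c : C) (a b : V), f (c *: a + b) = c *: f a + f b,
      f (vac V) = vac V' &
      forall (a : V) (n : int) (b : V), f (nprod a n b) = nprod (f a) n (f b)].

Definition va_ideal (V : vertexAlgebra) (I : V -> Prop) : Prop :=
  subspace I /\
  forall (a u : V) (n : int), I u -> I (nprod a n u) /\ I (nprod u n a).

Definition va_simple (V : vertexAlgebra) : Prop :=
  (exists a : V, a <> 0) /\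
  forall I : V -> Prop, va_ideal I ->
    (forall a, I a -> a = 0) \/ (forall a, I a).

Definition simple_quotient (V S : vertexAlgebra) (pi : V -> S) : Prop :=
  [/\ va_hom pi, forall s : S, exists a : V, pi a = s & va_simple S].

Definition submodule (V : vertexAlgebra) (M : vaModule V) (P : M -> Prop) : Prop :=
  subspace P /\ forall (a : V) (n : int) (w : M), P w -> P (mact a n w).

Definition generated_by (V : vertexAlgebra) (M : vaModule V) (v : M) : Prop :=
  forall P : M -> Prop, submodule P -> P v -> forall w, P w.

Definition irreducible (V : vertexAlgebra) (M : vaModule V) : Prop :=
  (exists w : M, w <> 0) /\
  forall P : M -> Prop, submodule P ->
    (forall w, P w -> w = 0) \/ (forall w, P w).

Definition factors_through (V S : vertexAlgebra) (pi : V -> S)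
    (M : vaModule V) : Prop :=
  exists act : S -> int -> M -> M,
    [/\ bilinear_modes act,
        truncated_modes act,
        forall (n : int) (w : M), act (vac S) n w = if n == -1 then w else 0,
        borcherds (@nprod S) act &
        forall (a : V) (n : int) (w : M), mact a n w = act (pi a) n w].

(* [X] strongly generates [V]: the monomials
   a1_(-n1-1) ... ar_(-nr-1) vac with ai in X and ni >= 0 span V. *)
Definition strongly_generates (V : vertexAlgebra) (X : V -> Prop) : Prop :=
  forall P : V -> Prop, subspace P -> P (vac V) ->
    (forall (a : V) (n : nat) (u : V), X a -> P u -> P (nprod a (- n.+1%:Z) u)) ->
  forall v, P v.

(* a(z)b(w) ~ sum_(n >= 0) s`_n (z-w)^(-n-1), i.e. a_(n) b = s`_n for n >= 0:
   the coefficients are listed from the simple pole upwards. *)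
Definition ope (V : vertexAlgebra) (a b : V) (s : seq V) : Prop :=
  forall n : nat, nprod a n%:Z b = s`_n.

Record bpFields (V : vertexAlgebra) :=
  BPFields { fJ : V; fT : V; fGp : V; fGm : V }.

Definition central_charge (k : C) : C :=
  - ((3 * k + 1) * (2 * k + 3) / (k + 3)).

Record bp_opes (k : C) (V : vertexAlgebra) (X : bpFields V) : Prop := BPOpes {
  ope_JJ : ope (fJ X) (fJ X) [:: 0; ((2 * k + 3) / 3) *: vac V];
  ope_GpGp : ope (fGp X) (fGp X) [::];
  ope_GmGm : ope (fGm X) (fGm X) [::];
  ope_JGp : ope (fJ X) (fGp X) [:: fGp X];
  ope_JGm : ope (fJ X) (fGm X) [:: - fGm X];
  ope_TT : ope (fT X) (fT X)
    [:: transl (fT X); 2 *: fT X; 0; (central_charge k / 2) *: vac V];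
  ope_TGp : ope (fT X) (fGp X) [:: transl (fGp X); (3 / 2) *: fGp X];
  ope_TGm : ope (fT X) (fGm X) [:: transl (fGm X); (3 / 2) *: fGm X];
  ope_TJ : ope (fT X) (fJ X) [:: transl (fJ X); fJ X];
  ope_GpGm : ope (fGp X) (fGm X)
    [:: 3 *: nprod (fJ X) (-1) (fJ X) + (3 * (k + 1) / 2) *: transl (fJ X)
          - (k + 3) *: fT X;
        (3 * (k + 1)) *: fJ X;
        ((k + 1) * (2 * k + 3)) *: vac V]
}.

Definition bp_algebra (k : C) (V : vertexAlgebra) (X : bpFields V) : Prop :=
  bp_opes k X /\
  strongly_generates (fun a => [\/ a = fJ X, a = fT X, a = fGp X | a = fGm X]).

(* Uniqueness of [f] is automatic by strong generation. *)
Definition universal_bp (k : C) (W : vertexAlgebra) (X : bpFields W) : Prop :=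
  bp_algebra k X /\
  forall (V : vertexAlgebra) (Y : bpFields V), bp_algebra k Y ->
    exists f : W -> V, va_hom f /\
      [/\ f (fJ X) = fJ Y, f (fT X) = fT Y, f (fGp X) = fGp Y & f (fGm X) = fGm Y].

Section HighestWeight.

Variables (W : vertexAlgebra) (X : bpFields W) (M : vaModule W).

Definition Jmode (n : int) (w : M) : M := mact (fJ X) n w.

(* L(n) = L_n - (n+1)/2 J_n, where L_n = T_(n+1) *)
Definition Lmode (n : int) (w : M) : M :=
  mact (fT X) (n + 1) w - ((n + 1)%:~R / 2) *: mact (fJ X) n w.

Definition Gpmode (n : int) (w : M) : M := mact (fGp X) n w.

Definition Gmmode (n : int) (w : M) : M := mact (fGm X) (n + 1) w.

Definition highest_weight_vector (x y : C) (v : M) : Prop :=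
  [/\ v <> 0, Jmode 0 v = x *: v, Lmode 0 v = y *: v &
      forall n : int, 1 <= n ->
        [/\ Jmode n v = 0, Lmode n v = 0, Gpmode n v = 0 & Gmmode (n - 1) v = 0]].

(* M is (isomorphic to) L(x,y) *)
Definition is_L (x y : C) : Prop :=
  irreducible M /\
  exists v : M, highest_weight_vector x y v /\ generated_by v.

End HighestWeight.

(* Irreducible modules in category O over the quotient S of W are the L(x,y)
   on which the action of W factors through S. *)
Definition irreducible_in_O (W S : vertexAlgebra) (pi : W -> S)
    (X : bpFields W) (M : vaModule W) : Prop :=
  (exists x y : C, is_L X M x y) /\ factors_through pi M.

Definition h1 (x y : C) : C := - 3 * x ^+ 2 + x + 2 * y.

Definition S_minus1 (x y : C) : Prop := h1 x y = 0.

End VertexAlgebras.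

(* Main.v *)
(* At [k = -1] put tau = Gp_(0) Gm = 3 :JJ: - 2 T, so that [Gp_m, Gm_n] =
   tau_(m+n), and tau_1 acts on a highest weight vector of weight (x, y) by
   - h1(x, y).  If h1(x, y) = 0 and M is irreducible, the vectors Gp_n v and
   Gm_n v are, one n after the other, annihilated by all weight lowering modes,
   hence zero; so Gp, Gm and tau annihilate M.  For M the simple quotient
   W_(-1), which is L(0,0), this says that Gp, Gm, tau vanish in W_(-1), and
   the condition h1 = 0 is necessary.  Conversely, when Gp, Gm, tau annihilate
   M the algebra W/Ann(M) is generated by the Heisenberg field J.  In it T is
   the Sugawara vector (3/2) :JJ:, so a vector killed by all J_i, i > 0, is
   killed by T_1, hence a multiple of the vacuum; therefore Ann(M) is the
   largest proper ideal and M is a W_(-1)-module.  Finally L(x,y) with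
   h1(x, y) = 0 is constructed by twisting W_(-1) with Li's operator
   exp(sum_(i > 0) c (-1)^(i+1)/i J_i z^(-i)), c = 3 x, which moves the eigenvalue
   of J_0 from 0 to x. *)

Require Import Defs.
From mathcomp Require Import all_boot all_order all_algebra.
From mathcomp Require Import boolp reals.
From mathcomp Require Import zify ring.

Set Implicit Arguments.
Unset Strict Implicit.
Unset Printing Implicit Defensive.

Import Order.TTheory GRing.Theory Num.Theory.
Local Open Scope ring_scope.
Local Open Scope complex_scope.

(** * Finite sums of sequences *)

(** Neither [V] nor [M] comes with a grading. Strong generation yields only spanning families of
    [T_(1)]-eigenvectors, with no independence, so weight arguments are replaced by elimination: a
    sum of eigenvectors with eigenvalues other than [mu], on which [T_(1) - mu] vanishes modulo an
    invariant subspace, lies in that subspace. The same device serves irreducible modules and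
    ideals.

    Maximality of the annihilator [Ann(M)] is obtained only among the ideals that contain it. To
    compare it with the kernel of [pi], which need not contain it a priori, one also needs that two
    proper ideals never add up to the whole algebra.

    Li's operator in general has a further factor [z^(c h_(0))]. It is trivial here because
    [J_(0) = 0] on the simple quotient; this is what lets [c] be any complex number while all modes
    stay integral. The exponential is a finite sum on each vector because the [J_(i)], [i > 0], are
    locally nilpotent, and the Borcherds identity of the twist is checked degree by degree in
    [c]. *)

Section FiniteSums.

Variable U : zmodType.
Implicit Types f g : nat -> U.

Definition vanishes_from (N : nat) f := forall j, (N <= j)%N -> f j = 0.
Definition finsupp f := exists N, vanishes_from N f.

(* 0 unless [f] has finite support. *)
Definition fsum f : U :=
  if pselect (finsupp f) is left H then \sum_(j < sval (cid H)) f j else 0.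

Lemma sum_vanishes f M N : (M <= N)%N -> vanishes_from M f ->
  \sum_(j < N) f j = \sum_(j < M) f j.
Proof.
move=> leMN fM; rewrite (big_ord_widen N f leMN) [RHS]big_mkcond /=.
by apply: eq_bigr => j _; case: ltnP => // /fM.
Qed.

Lemma fsumE f N : vanishes_from N f -> fsum f = \sum_(j < N) f j.
Proof.
move=> fN; rewrite /fsum; case: pselect => [H|[]]; last by exists N.
case: (cid H) => M /= fM; case: (leqP M N) => [le|/ltnW le].
  by rewrite -(sum_vanishes le fM).
by rewrite -(sum_vanishes le fN).
Qed.

Lemma fsum_ext f g : f =1 g -> fsum f = fsum g.
Proof. by move=> /funext ->. Qed.

Lemma fsum0 f : (forall j, f j = 0) -> fsum f = 0.
Proof. by move=> f0; rewrite (@fsumE _ 0) ?big_ord0. Qed.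

Lemma fsum1 f : vanishes_from 1 f -> fsum f = f 0%N.
Proof. by move=> /fsumE ->; rewrite big_ord1. Qed.

Lemma vanishes_max f M N : vanishes_from M f -> vanishes_from (maxn M N) f.
Proof. by move=> fM j /(leq_trans (leq_maxl M N))/fM. Qed.

Lemma vanishes_maxr f M N : vanishes_from N f -> vanishes_from (maxn M N) f.
Proof. by rewrite maxnC; apply: vanishes_max. Qed.

Lemma finsuppD f g : finsupp f -> finsupp g -> finsupp (fun j => f j + g j).
Proof.
move=> [M fM] [N gN]; exists (maxn M N) => j le.
move: le; rewrite geq_max => /andP[/fM -> /gN ->]; exact: addr0.
Qed.

Lemma fsumD f g : finsupp f -> finsupp g ->
  fsum (fun j => f j + g j) = fsum f + fsum g.
Proof.
move=> [M fM] [N gN].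
have fMN := vanishes_max (N := N) fM; have gMN := vanishes_maxr (M := M) gN.
rewrite (fsumE fMN) (fsumE gMN) -big_split /=; apply: fsumE => j le.
by rewrite fMN ?gMN ?addr0.
Qed.

Lemma fsum_sum n (F : nat -> nat -> U) : (forall s, finsupp (F s)) ->
  fsum (fun j => \sum_(s < n) F s j) = \sum_(s < n) fsum (F s).
Proof.
move=> fin; suff [//] : fsum (fun j => \sum_(s < n) F s j) = \sum_(s < n) fsum (F s)
  /\ finsupp (fun j => \sum_(s < n) F s j).
elim: n => [|n [IH finIH]].
  split; last by exists 0%N => j _; rewrite big_ord0.
  by rewrite big_ord0; apply: fsum0 => j; rewrite big_ord0.
under [X in finsupp X]eq_fun do rewrite big_ord_recr.
rewrite big_ord_recr /= -IH -fsumD //; split; last exact: finsuppD.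
by apply: fsum_ext => j; rewrite big_ord_recr.
Qed.

Lemma fsum_shift f l : (forall i, (i < l)%N -> f i = 0) ->
  fsum f = fsum (fun s => f (l + s)%N).
Proof.
move=> fl; case: (pselect (finsupp f)) => [[N fN]|nf].
  have fN' : vanishes_from (l + N) f by move=> j lej; apply: fN; lia.
  rewrite (fsumE fN') (@fsumE _ N); last by move=> s le; apply: fN; lia.
  by rewrite big_split_ord /= big1 ?add0r // => i _; apply: fl.
rewrite /fsum; case: pselect => // _; case: pselect => // -[N fN].
case: nf; exists (l + N)%N => j le; rewrite -(subnKC (n := j) (m := l)) ?fN //; lia.
Qed.

(** Merges truncation bounds that depend on an index into one bound, when only finitely many indices
    matter. *)
Lemma uniform_bound (Q : nat -> nat -> Prop) L :
  (forall l M N, (M <= N)%N -> Q l M -> Q l N) ->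
  (forall l, exists N, Q l N) -> exists N, forall l, (l < L)%N -> Q l N.
Proof.
move=> mono ex; elim: L => [|L [N IH]]; first by exists 0%N.
have [M QM] := ex L; exists (maxn M N) => l; rewrite ltnS leq_eqVlt.
case/orP=> [/eqP ->|/IH]; last by apply: mono; rewrite leq_maxr.
by apply: mono QM; rewrite leq_maxl.
Qed.

Lemma finsupp2_bound (F : nat -> nat -> U) :
  (exists L, forall l j, (L <= l)%N -> F l j = 0) ->
  (forall l, finsupp (F l)) ->
  exists N, forall l j, (N <= l)%N || (N <= j)%N -> F l j = 0.
Proof.
move=> [L FL] Ffin.
have [||N FN] := @uniform_bound (fun l N => vanishes_from N (F l)) L.
- by move=> l M N le FM j /(leq_trans le)/FM.
- exact: Ffin.
exists (maxn L N) => l j; rewrite !geq_max.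
case: (leqP L l) => [/FL -> //|lL /=] /andP[_]; exact: FN.
Qed.

(** The hypotheses are asymmetric because truncation is: the bound on [l] is uniform in [j], the
    bound on [j] depends on [l]. Only finitely many [l] matter, so this suffices. *)
Lemma fsum_exchange (F : nat -> nat -> U) :
  (exists L, forall l j, (L <= l)%N -> F l j = 0) ->
  (forall l, finsupp (F l)) ->
  fsum (fun l => fsum (F l)) = fsum (fun j => fsum (F^~ j)).
Proof.
move=> FL Ffin; have [N FN] := finsupp2_bound FL Ffin.
have E1 l : fsum (F l) = \sum_(j < N) F l j.
  by apply: fsumE => j le; rewrite FN ?le ?orbT.
have E2 j : fsum (F^~ j) = \sum_(l < N) F l j.
  by apply: fsumE => l le; rewrite FN ?le.
rewrite (fsum_ext E1) (fsum_ext E2) !(@fsumE _ N) 1?exchange_big // => j le.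
- by rewrite big1 // => i _; rewrite FN ?le ?orbT.
- by rewrite big1 // => i _; rewrite FN ?le.
Qed.

Lemma fsum_antidiagonal (F : nat -> nat -> U) :
  (exists N, forall j s, (N <= j + s)%N -> F j s = 0) ->
  fsum (fun j => fsum (F j)) =
  fsum (fun p => \sum_(s < p.+1) F (p - s)%N s).
Proof.
move=> [N FN].
have finF : forall l, finsupp (F l).
  by move=> l; exists N => j le; apply: FN; lia.
rewrite fsum_exchange //; last by exists N => l j le; apply: FN; lia.
(* Column [s] shifted to start at [p = s], so that exchanging the sums collects the terms with
   [j + s = p]. *)
pose G s p := if (s <= p)%N then F (p - s)%N s else 0.
have E1 s : fsum (F^~ s) = fsum (G s).
  rewrite (@fsum_shift (G s) s); last by move=> i; rewrite ltnNge /G => /negbTE ->.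
  by apply: fsum_ext => j; rewrite /G leq_addr addKn.
rewrite (fsum_ext E1) fsum_exchange.
- apply: fsum_ext => p; rewrite (@fsumE _ p.+1).
    by apply: eq_bigr => s _; rewrite /G -ltnS ltn_ord.
  by move=> j; rewrite /G ltnNge => /negbTE ->.
- by exists N => s p le; rewrite /G; case: leqP => // ?; apply: FN; lia.
- by move=> s; exists N => p le; rewrite /G; case: leqP => // ?; apply: FN; lia.
Qed.

End FiniteSums.

Lemma fsum_additive (U U' : zmodType) (phi : U -> U') (f : nat -> U) :
  (forall u v, phi (u + v) = phi u + phi v) -> finsupp f ->
  phi (fsum f) = fsum (fun j => phi (f j)).
Proof.
move=> phiD [N fN].
have phi0 : phi 0 = 0 by apply: (addrI (phi 0)); rewrite -phiD !addr0.
rewrite (fsumE fN) (@fsumE _ _ N); last by move=> j /fN ->.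
by apply: (big_morph phi phiD phi0).
Qed.

Lemma fsumZ (C : pzRingType) (U : lmodType C) (c : C) (f : nat -> U) :
  finsupp f -> fsum (fun j => c *: f j) = c *: fsum f.
Proof.
move=> fin; rewrite -(@fsum_additive _ _ (GRing.scale c)) // => u v.
by rewrite scalerDr.
Qed.

Lemma finsuppZ (C : pzRingType) (U : lmodType C) (c : nat -> C) (f : nat -> U) :
  finsupp f -> finsupp (fun j => c j *: f j).
Proof. by move=> [N fN]; exists N => j /fN ->; rewrite scaler0. Qed.

(** * Binomial coefficients with integer upper argument *)

Section Binomials.

Variable C : numFieldType.
Local Notation binz := (binz C).

Lemma binz0 m : binz m 0 = 1.
Proof. by rewrite /binz big_ord0 divr1. Qed.

Lemma binzS m j : binz m j.+1 * j.+1%:R = binz m j * (m - j%:Z)%:~R.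
Proof.
rewrite /binz big_ord_recr /= factS natrM.
have ne1 : j`!%:R != 0 :> C by rewrite pnatr_eq0 -lt0n fact_gt0.
have ne2 : j.+1%:R != 0 :> C by rewrite pnatr_eq0.
by move: j.+1%:R j`!%:R ne1 ne2 => s t t0 s0; field; rewrite t0 s0.
Qed.

Lemma binz1 m : binz m 1 = m%:~R.
Proof. by have := binzS m 0; rewrite binz0 mulr1 mul1r subr0. Qed.

Lemma binzSE m j : binz m j.+1 = binz m j * (m - j%:Z)%:~R / j.+1%:R.
Proof. by rewrite -binzS mulfK // pnatr_eq0. Qed.

Lemma binz_small (i j : nat) : (i < j)%N -> binz i%:Z j = 0.
Proof.
move=> lt; rewrite /binz (bigD1 (Ordinal lt)) //= subrr.
by rewrite mulr0z !mul0r.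
Qed.

Lemma binz0S j : binz 0 j.+1 = 0.
Proof. exact: (@binz_small 0). Qed.

(** Induction on [p]: the factor [p.+1] splits as [s + (p.+1 - s)], and [binzS] absorbs one summand
    into each binomial. *)
Lemma binz_Vandermonde a b p :
  \sum_(s < p.+1) binz a s * binz b (p - s)%N = binz (a + b) p.
Proof.
elim: p => [|p IH]; first by rewrite big_ord1 !binz0 mulr1.
apply: (@mulIf _ p.+1%:R); first by rewrite pnatr_eq0.
rewrite binzS -IH !mulr_suml.
transitivity (\sum_(s < p.+2) (binz a s * s%:R) * binz b (p.+1 - s)%N +
  \sum_(s < p.+2) binz a s * (binz b (p.+1 - s)%N * (p.+1 - s)%N%:R)).
  rewrite -big_split /=; apply: eq_bigr => s _.
  have -> : p.+1%:R = s%:R + (p.+1 - s)%N%:R :> C.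
    by rewrite -natrD subnKC // -ltnS.
  by ring.
rewrite big_ord_recl /= mulr0 mul0r add0r.
rewrite [X in _ + X]big_ord_recr /= subnn mulr0 mulr0 addr0 -big_split /=.
apply: eq_bigr => -[s /= les] _; rewrite /bump /= add1n subSS (@subSn s p les).
have -> : a + b - p%:Z = (a - s%:Z) + (b - (p - s)%N%:Z) by move: les; lia.
by rewrite !binzS rmorphD /=; ring.
Qed.

End Binomials.

(** * Consequences of the Borcherds identity *)

Section Subspaces.

Variables (C : numFieldType) (U : lmodType C) (P : U -> Prop).
Hypothesis sP : subspace P.

Lemma subspace0 : P 0. Proof. by case: sP. Qed.

Lemma subspaceD u v : P u -> P v -> P (u + v).
Proof. by case: sP => _ lin Pu Pv; rewrite -[u]scale1r; apply: lin. Qed.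

Lemma subspaceZ c u : P u -> P (c *: u).
Proof. by case: sP => P0 lin Pu; rewrite -[_ *: _]addr0; apply: lin. Qed.

Lemma subspaceN u : P u -> P (- u).
Proof. by rewrite -scaleN1r; apply: subspaceZ. Qed.

Lemma subspaceB u v : P u -> P v -> P (u - v).
Proof. by move=> Pu Pv; apply: subspaceD => //; apply: subspaceN. Qed.

Lemma subspaceZE c u : c != 0 -> P (c *: u) -> P u.
Proof. by move=> c0 /(subspaceZ c^-1); rewrite scalerA mulVf // scale1r. Qed.

Lemma subspaceDE u v : P v -> P (u + v) -> P u.
Proof. by move=> Pv Puv; rewrite -(addrK v u); apply: subspaceB. Qed.

Lemma subspace_sum (I : eqType) (s : seq I) (f : I -> U) :
  (forall i, i \in s -> P (f i)) -> P (\sum_(i <- s) f i).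
Proof.
move=> Pf; rewrite big_seq; apply: big_ind => //; first exact: subspace0.
exact: subspaceD.
Qed.

Lemma subspace_ord_sum n (f : 'I_n -> U) : (forall i, P (f i)) -> P (\sum_i f i).
Proof. by move=> Pf; apply: big_ind => //; [exact: subspace0 | exact: subspaceD]. Qed.

Lemma subspace_fsum f : (forall j, P (f j)) -> P (fsum f).
Proof.
move=> Pf; rewrite /fsum; case: pselect => H; last exact: subspace0.
exact: subspace_ord_sum.
Qed.

End Subspaces.

Section Actions.

Variables (C : numFieldType) (V : vertexAlgebra C) (M : lmodType C).
Variable act : V -> int -> M -> M.
Hypotheses (bil : bilinear_modes act) (tr : truncated_modes act).

Lemma actDl a b n w : act (a + b) n w = act a n w + act b n w.
Proof. by have := bil.1 n w 1 a b; rewrite !scale1r. Qed.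

Lemma act0l n w : act 0 n w = 0.
Proof. by apply: (addrI (act 0 n w)); rewrite -actDl !addr0. Qed.

Lemma actZl c a n w : act (c *: a) n w = c *: act a n w.
Proof. by have := bil.1 n w c a 0; rewrite act0l !addr0. Qed.

Lemma actNl a n w : act (- a) n w = - act a n w.
Proof. by rewrite -scaleN1r actZl scaleN1r. Qed.

Lemma actDr a n u w : act a n (u + w) = act a n u + act a n w.
Proof. by have := bil.2 a n 1 u w; rewrite !scale1r. Qed.

Lemma act0r a n : act a n 0 = 0.
Proof. by apply: (addrI (act a n 0)); rewrite -actDr !addr0. Qed.

Lemma actZr c a n w : act a n (c *: w) = c *: act a n w.
Proof. by have := bil.2 a n c w 0; rewrite act0r !addr0. Qed.

Lemma actNr a n w : act a n (- w) = - act a n w.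
Proof. by rewrite -scaleN1r actZr scaleN1r. Qed.

Lemma act_vanishes a w : exists N : nat, forall n : int, N%:Z <= n -> act a n w = 0.
Proof.
have [N HN] := tr a w; exists `|N|%N => n le; apply: HN.
exact: le_trans (ler_norm N) le.
Qed.

Lemma act_finsupp a n w : finsupp (fun j : nat => act a (n + j%:Z) w).
Proof.
have [N HN] := act_vanishes a w; exists (N + `|n|)%N => j le; apply: HN; lia.
Qed.

Definition left_sum a b (m n k : int) w : M :=
  fsum (fun j : nat => binz C m j *: act (nprod a (n + j%:Z) b) (m + k - j%:Z) w).

(** Two actions are allowed because in the twist [a] and [b] act through homogeneous parts of
    different degrees. *)
Definition right_sum (act' : V -> int -> M -> M) a b (m n k : int) w : M :=
  fsum (fun j : nat => ((-1) ^+ j * binz C n j) *: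
    (act a (m + n - j%:Z) (act' b (k + j%:Z) w)
     - (-1) ^ n *: act' b (n + k - j%:Z) (act a (m + j%:Z) w))).

Lemma nprod_finsupp (a b : V) n : finsupp (fun j : nat => nprod a (n + j%:Z) b).
Proof.
have [N HN] := nprod_truncated a b; exists (`|N| + `|n|)%N => j le.
by apply: HN; move: le; lia.
Qed.

Lemma left_sum_finsupp a b (m n k : int) w :
  finsupp (fun j : nat => binz C m j *: act (nprod a (n + j%:Z) b) (m + k - j%:Z) w).
Proof.
have [N HN] := nprod_finsupp a b n; exists N => j /HN ->.
by rewrite act0l scaler0.
Qed.

End Actions.

Section RightSums.

Variables (C : numFieldType) (V : vertexAlgebra C) (M : lmodType C).
Variables act act' : V -> int -> M -> M.
Hypotheses (bil : bilinear_modes act) (tr : truncated_modes act).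
Hypotheses (bil' : bilinear_modes act') (tr' : truncated_modes act').

Lemma right_sum_finsupp a b (m n k : int) w :
  finsupp (fun j : nat => ((-1) ^+ j * binz C n j) *:
    (act a (m + n - j%:Z) (act' b (k + j%:Z) w)
     - (-1) ^ n *: act' b (n + k - j%:Z) (act a (m + j%:Z) w))).
Proof.
have [K HK] := act_finsupp tr' b k w; have [N HN] := act_finsupp tr a m w.
exists (maxn K N) => j; rewrite geq_max => /andP[/HK -> /HN ->].
by rewrite (act0r bil) (act0r bil') scaler0 subr0 scaler0.
Qed.

End RightSums.

Lemma borcherdsP (C : numFieldType) (V : vertexAlgebra C) (M : lmodType C)
    (act : V -> int -> M -> M) :
  bilinear_modes act -> truncated_modes act ->
  borcherds (@nprod C V) act <->
  forall a b m n k w, left_sum act a b m n k w = right_sum act act a b m n k w.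
Proof.
move=> bil tr; split=> [bor a b m n k w|E a b m n k w].
  have [N0 HN] := bor a b m n k w.
  have [L HL] := left_sum_finsupp bil a b m n k w.
  have [R HR] := right_sum_finsupp bil tr bil tr a b m n k w.
  pose N := maxn N0 (maxn L R).
  rewrite /left_sum /right_sum (@fsumE _ _ N); last first.
    by move=> j; rewrite !geq_max => /and3P[_ /HL].
  rewrite (@fsumE _ _ N); last by move=> j; rewrite !geq_max => /and3P[_ _ /HR].
  by apply: HN; rewrite leq_maxl.
have [L HL] := left_sum_finsupp bil a b m n k w.
have [R HR] := right_sum_finsupp bil tr bil tr a b m n k w.
exists (maxn L R) => N; rewrite geq_max => /andP[leL leR].
have := E a b m n k w; rewrite /left_sum /right_sum (@fsumE _ _ N); last first.
  by move=> j /(leq_trans leL)/HL.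
by rewrite (@fsumE _ _ N) // => j /(leq_trans leR)/HR.
Qed.

Section Modules.

Variables (C : numFieldType) (V : vertexAlgebra C).

Definition adjoint_module : vaModule V :=
  VaModule (nprod_bilinear V) (@nprod_truncated C V) (@nprod_vacl C V)
    (@nprod_borcherds C V).

Variable M : vaModule V.
Implicit Types (a b : V) (w : M).

Let bil := mact_bilinear M.
Let tr := @mact_truncated C V M.

Lemma mact_borcherdsE a b m n k w :
  left_sum (@mact _ _ M) a b m n k w = right_sum (@mact _ _ M) (@mact _ _ M) a b m n k w.
Proof. by move: a b m n k w; apply/(borcherdsP bil tr)/(@mact_borcherds C V M). Qed.

(** The Borcherds identity at [n = 0], where [binz 0 j] leaves a single term on the right;
    [mact_iterate] is the case [m = 0], with a single term on the left. *)
Lemma mact_commutator a b m k w :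
  mact a m (mact b k w) - mact b k (mact a m w) =
  fsum (fun j : nat => binz C m j *: mact (nprod a j%:Z b) (m + k - j%:Z) w).
Proof.
have := mact_borcherdsE a b m 0 k w; rewrite /left_sum /right_sum.
rewrite [in RHS]fsum1; last first.
  by case=> // j _; rewrite binz0S mulr0 scale0r.
rewrite expr0 binz0 mulr1 !scale1r !addr0 ?add0r => <-.
by apply: fsum_ext => j; rewrite add0r.
Qed.

Lemma mact_iterate a b n k w :
  mact (nprod a n b) k w =
  fsum (fun j : nat => ((-1) ^+ j * binz C n j) *:
    (mact a (n - j%:Z) (mact b (k + j%:Z) w)
     - (-1) ^ n *: mact b (n + k - j%:Z) (mact a j%:Z w))).
Proof.
have := mact_borcherdsE a b 0 n k w; rewrite /left_sum /right_sum.
rewrite [in LHS]fsum1; last first.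
  by case=> // j _; rewrite binz0S scale0r.
rewrite binz0 scale1r addr0 add0r subr0 => ->; apply: fsum_ext => j.
by rewrite !add0r.
Qed.

Section Closed.

Variable P : M -> Prop.
Hypothesis sP : subspace P.

Lemma mact_swap_closed a b m k w :
  P (mact b k (mact a m w)) ->
  (forall j : nat, P (mact (nprod a j%:Z b) (m + k - j%:Z) w)) ->
  P (mact a m (mact b k w)).
Proof.
move=> Pba Pj; rewrite -[X in P X](subrK (mact b k (mact a m w))).
rewrite mact_commutator; apply: subspaceD => //; apply: subspace_fsum => // j.
exact: subspaceZ.
Qed.

Lemma mact_swapr_closed a b m k w :
  P (mact a m (mact b k w)) ->
  (forall j : nat, P (mact (nprod a j%:Z b) (m + k - j%:Z) w)) ->
  P (mact b k (mact a m w)).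
Proof.
move=> Pab Pj; have -> : mact b k (mact a m w) = mact a m (mact b k w) -
   (mact a m (mact b k w) - mact b k (mact a m w)) by rewrite opprB addrC subrK.
rewrite mact_commutator; apply: subspaceB => //; apply: subspace_fsum => // j.
exact: subspaceZ.
Qed.

Lemma mact_iterate_closed a b n k w :
  (forall j : nat, P (mact a (n - j%:Z) (mact b (k + j%:Z) w))) ->
  (forall j : nat, P (mact b (n + k - j%:Z) (mact a j%:Z w))) ->
  P (mact (nprod a n b) k w).
Proof.
move=> P1 P2; rewrite mact_iterate; apply: subspace_fsum => // j.
by apply: subspaceZ => //; apply: subspaceB => //; apply: subspaceZ.
Qed.

(* With [N] large enough that [mact a i w = 0] for [i >= N], the Borcherds
   identity at [m = N] has only one kind of term on each side; its leading term
   is [mact a m (mact b n w)], and the others have a larger mode of [b]. *)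
Lemma mact_product_closed a b w :
  (forall i k, P (mact (nprod a i b) k w)) ->
  forall m n, P (mact a m (mact b n w)).
Proof.
move=> Pab m n; have [K HK] := act_vanishes tr b w.
have [N HN] := act_vanishes tr a w.
have [d] : exists d : nat, K%:Z - d%:Z <= n by exists (K + `|n|)%N; lia.
elim: d m n => [|d IH] m n le.
  by rewrite HK ?(act0r bil); [exact: subspace0 | lia].
have := mact_borcherdsE a b N%:Z (m - N%:Z) n w; rewrite /left_sum /right_sum.
set L := fsum _ => E.
have PL : P L by apply: subspace_fsum => // j; apply: subspaceZ.
move: PL; rewrite {}E (@fsum_ext _ _ (fun j : nat =>
  ((-1) ^+ j * binz C (m - N%:Z) j) *: mact a (m - j%:Z) (mact b (n + j%:Z) w))).
  set f := (fun _ => _); have [B fB] : finsupp f.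
    have [B HB] := act_finsupp tr b n w; exists B => j /HB; rewrite /f => ->.
    by rewrite (act0r bil) scaler0.
  have fB' : vanishes_from B.+1 f by move=> j /ltnW /fB.
  rewrite (fsumE fB') big_ord_recl => Psum.
  suff : P (f 0%N) by rewrite /f expr0 binz0 mulr1 scale1r subr0 addr0.
  apply: (subspaceDE sP _ Psum); apply: subspace_ord_sum => // j.
  by rewrite /f lift0; apply: subspaceZ => //; apply: IH; lia.
move=> j; rewrite [mact a (N%:Z + _) w]HN; last by lia.
by rewrite (act0r bil) scaler0 subr0 [N%:Z + _]addrC subrK.
Qed.

End Closed.

End Modules.

Section VertexAlgebraIdentities.

Variables (C : numFieldType) (V : vertexAlgebra C).
Implicit Types a b u : V.

Lemma nprod_commutator a b m k u :
  nprod a m (nprod b k u) - nprod b k (nprod a m u) =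
  fsum (fun j : nat => binz C m j *: nprod (nprod a j%:Z b) (m + k - j%:Z) u).
Proof. exact: (mact_commutator (M := adjoint_module V)). Qed.

Lemma nprod_iterate a b n k u :
  nprod (nprod a n b) k u =
  fsum (fun j : nat => ((-1) ^+ j * binz C n j) *:
    (nprod a (n - j%:Z) (nprod b (k + j%:Z) u)
     - (-1) ^ n *: nprod b (n + k - j%:Z) (nprod a j%:Z u))).
Proof. exact: (mact_iterate (M := adjoint_module V)). Qed.

End VertexAlgebraIdentities.

(** * Grading and lowering modes *)

Lemma fsum_single (U : zmodType) (f : nat -> U) (i : nat) :
  (forall j, j != i -> f j = 0) -> fsum f = f i.
Proof.
move=> fi; rewrite (@fsum_shift _ f i) => [|j lt]; last by rewrite fi // ltn_eqF.
by rewrite fsum1 ?addn0 // => j j0; rewrite fi //; lia.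
Qed.

Lemma subspace_zero (C : numFieldType) (U : lmodType C) :
  subspace (fun u : U => u = 0).
Proof. by split=> // c u v -> ->; rewrite scaler0 addr0. Qed.

(* Modulo [I], each eigenvector in the sum is killed by some [L - la] with
   [la != mu], while [L - mu] kills the sum. *)
Lemma eigen_elimination (C : numFieldType) (U : lmodType C) (L : U -> U)
    (I : U -> Prop) (mu : C) (s : seq (C * U)) :
  (forall c u v, L (c *: u + v) = c *: L u + L v) ->
  subspace I -> (forall u, I u -> I (L u)) ->
  (forall p, p \in s -> L p.2 = p.1 *: p.2 /\ p.1 != mu) ->
  I (L (\sum_(p <- s) p.2) - mu *: \sum_(p <- s) p.2) ->
  I (\sum_(p <- s) p.2).
Proof.
move=> lin sI IL.
have L0 : L 0 = 0.
  by have := lin (-1) 0 0; rewrite scaler0 addr0 scaleN1r addNr.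
have LD v w : L (v + w) = L v + L w by have := lin 1 v w; rewrite !scale1r.
have LZ c v : L (c *: v) = c *: L v by have := lin c v 0; rewrite L0 !addr0.
have LN v : L (- v) = - L v by rewrite -scaleN1r LZ scaleN1r.
elim: {s}(size s) {-2}s (erefl (size s)) => [|n IH] [|[la u] s] //= size_s eig.
  by move=> _; rewrite big_nil; exact: subspace0.
have [/= Lu la_mu] := eig (la, u) (mem_head _ _).
set x := \sum_(p <- _) _ => Ix.
pose s' := [seq (p.1, (p.1 - la) *: p.2) | p <- s].
have E : L x - la *: x = \sum_(q <- s') q.2.
  rewrite big_map /= /x big_cons /= LD Lu scalerDr opprD addrACA subrr add0r.
  rewrite (big_morph L LD L0) scaler_sumr -sumrB !big_seq; apply: eq_bigr => p ps.
  by rewrite (proj1 (eig p _)) ?in_cons ?ps ?orbT // scalerBl.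
have I1 : I (L x - la *: x).
  rewrite E; apply: IH; first by rewrite size_map; case: size_s.
    move=> _ /mapP[p ps ->] /=; have [] := eig p; first by rewrite in_cons ps orbT.
    by move=> Lp ?; rewrite LZ Lp !scalerA mulrC.
  rewrite -E.
  have -> : L (L x - la *: x) - mu *: (L x - la *: x) =
     L (L x - mu *: x) - la *: (L x - mu *: x).
    rewrite !LD !LN !LZ !scalerBr !scalerA [mu * la]mulrC !opprB.
    by rewrite addrACA [RHS]addrACA; congr (_ + _); rewrite addrC.
  by apply: subspaceB => //; [exact: IL | exact: subspaceZ].
suff : I ((la - mu) *: x) by apply: subspaceZE => //; rewrite subr_eq0.
have -> : (la - mu) *: x = (L x - mu *: x) - (L x - la *: x).
  by rewrite scalerBl opprB [RHS]addrC addrA subrK.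
exact: subspaceB.
Qed.

Section Translation.

Variables (C : numFieldType) (V : vertexAlgebra C).

Lemma binzN2 j : (-1) ^+ j * binz C (-2) j = j.+1%:R.
Proof.
elim: j => [|j IH]; first by rewrite binz0 mulr1.
rewrite binzSE; move: (binz C (-2) j) IH => c IH.
have -> : -2 - j%:Z = - j.+2%:Z by lia.
have -> : (-1) ^+ j.+1 * (c * (- j.+2%:Z)%:~R / j.+1%:R) =
    ((-1) ^+ j * c) * j.+2%:R / j.+1%:R :> C.
  rewrite exprS rmorphN /= -pmulrn.
  by move: ((-1) ^+ j) j.+1%:R^-1 j.+2%:R => e f g; ring.
by rewrite IH mulrAC divff ?mul1r // pnatr_eq0.
Qed.

(** In the iterate formula for [a_(-2) vac] the modes of the vacuum leave at most one index:
    [j = -n - 1] from the first product if [n < 0], [j = n - 1] from the second if [n > 0], none if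
    [n = 0]. *)
Lemma mact_transl (M : vaModule V) a n (w : M) :
  mact (transl a) n w = - n%:~R *: mact a (n - 1) w.
Proof.
have bil := mact_bilinear M.
rewrite mact_iterate.
have [n_neg|n_ge0] := ltP n 0.
  pose i := `|(n + 1)%R|%N; rewrite (@fsum_single _ _ i).
    rewrite binzN2 !mact_vac.
    have -> : (n + i%:Z == -1) by apply/eqP; rewrite /i; lia.
    have -> : (-2 + n - i%:Z == -1) = false by apply/eqP; rewrite /i; lia.
    rewrite scaler0 subr0 -rmorphN pmulrn; congr (_%:~R *: mact _ _ _); rewrite /i; lia.
  move=> j ji; rewrite !mact_vac.
  have -> : (n + j%:Z == -1) = false by apply/eqP; move: ji; rewrite /i; lia.
  have -> : (-2 + n - j%:Z == -1) = false by apply/eqP; lia.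
  by rewrite (act0r bil) scaler0 subr0 scaler0.
have [->|n0] := eqVneq n 0.
  rewrite fsum0 ?oppr0 ?scale0r // => j; rewrite !mact_vac.
  have -> : (0 + j%:Z == -1) = false by apply/eqP; lia.
  have -> : (-2 + 0 - j%:Z == -1) = false by apply/eqP; lia.
  by rewrite (act0r bil) scaler0 subr0 scaler0.
pose i := `|(n - 1)%R|%N; rewrite (@fsum_single _ _ i).
  rewrite binzN2 !mact_vac.
  have -> : (n + i%:Z == -1) = false by apply/eqP; rewrite /i; lia.
  have -> : (-2 + n - i%:Z == -1) by apply/eqP; rewrite /i; lia.
  rewrite (act0r bil) sub0r scalerN -scaleNr pmulrn -!rmorphN.
  rewrite (_ : (-1) ^ (-2) = 1) ?scale1r; last by rewrite /exprz /= sqrrN expr1n invr1.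
  by congr (_%:~R *: mact _ _ _); rewrite /i; lia.
move=> j ji; rewrite !mact_vac.
have -> : (n + j%:Z == -1) = false by apply/eqP; lia.
have -> : (-2 + n - j%:Z == -1) = false by apply/eqP; move: ji; rewrite /i; lia.
by rewrite (act0r bil) scaler0 subr0 scaler0.
Qed.

Lemma transl_nprod a n b :
  transl (nprod a n b) = nprod a n (transl b) - n%:~R *: nprod a (n - 1) b :> V.
Proof.
have bil := nprod_bilinear V.
rewrite /transl nprod_iterate /=.
set f := (fun j => _).
have -> : fsum f = f 0%N + f 1%N.
  rewrite (@fsumE _ _ 2) ?big_ord_recr ?big_ord0 /= ?add0r // => -[|[|j]] // _.
  rewrite /f nprod_vacr0 (act0r bil) scaler0 subr0.
  by rewrite (_ : -2 + j.+2%:Z = j%:Z) ?nprod_vacr0 ?(act0r bil) ?scaler0 //; lia.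
rewrite /f !nprod_vacr0 !(act0r bil) !scaler0 !subr0 expr0 binz0 mulr1 scale1r.
by rewrite binz1 expr1 mulN1r scaleNr (_ : -2 + 1%:Z = -1) // nprod_vacr.
Qed.

Lemma nprod_transl a n (b : V) :
  nprod (transl a) n b = - n%:~R *: nprod a (n - 1) b.
Proof. exact: (mact_transl (M := adjoint_module V)). Qed.

End Translation.

(** * Conformal weights in a Bershadsky-Polyakov algebra and its modules *)

Section BershadskyPolyakov.

Variables (C : numFieldType) (k : C) (V : vertexAlgebra C) (X : bpFields V).
Hypotheses (opes : bp_opes k X).
Hypothesis gen_V :
  strongly_generates (fun a => [\/ a = fJ X, a = fT X, a = fGp X | a = fGm X]).

Let nbil := nprod_bilinear V.

(* Conformal weights are half-integers; [e] and [d] below are twice a weight. *)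
Inductive bp_generator : nat -> V -> Prop :=
| bp_generatorJ : bp_generator 2 (fJ X)
| bp_generatorT : bp_generator 4 (fT X)
| bp_generatorGp : bp_generator 3 (fGp X)
| bp_generatorGm : bp_generator 3 (fGm X).

Inductive bp_monomial : nat -> V -> Prop :=
| bp_monomial_vac : bp_monomial 0 (vac V)
| bp_monomial_cons e b p d a : bp_generator e b -> bp_monomial d a ->
    bp_monomial (e + p.*2 + d) (nprod b (- p.+1%:Z) a).

(** A span encoded as an intersection of subspaces, so that homogeneity is used by choosing [P].
    Nothing says that spans for different [d] are independent. *)
Definition bp_homogeneous (d : nat) (a : V) :=
  forall P : V -> Prop, subspace P -> (forall b, bp_monomial d b -> P b) -> P a.

Lemma bp_generator_gt1 e b : bp_generator e b -> (1 < e)%N.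
Proof. by case. Qed.

Lemma homogeneous_subspace d : subspace (bp_homogeneous d).
Proof.
split=> [P sP _|c u v hu hv P sP HP]; first exact: subspace0.
by apply: sP.2; [apply: hu | apply: hv].
Qed.

Lemma homogeneous_monomial d a : bp_monomial d a -> bp_homogeneous d a.
Proof. by move=> m P _; apply. Qed.

Lemma homogeneous_cons e b p d a : bp_generator e b -> bp_homogeneous d a ->
  bp_homogeneous (e + p.*2 + d) (nprod b (- p.+1%:Z) a).
Proof.
move=> gb ha; apply: (ha (fun a => bp_homogeneous _ (nprod b _ a))); last first.
  by move=> a' ma'; apply: homogeneous_monomial; apply: bp_monomial_cons.
split; first by rewrite (act0r nbil); exact: (subspace0 (homogeneous_subspace _)).
by move=> c u v; rewrite (nbil.2); apply: (homogeneous_subspace _).2.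
Qed.

Lemma homogeneous0 a : bp_homogeneous 0 a -> exists c, a = c *: vac V.
Proof.
move=> ha; apply: (ha (fun a => exists c, a = c *: vac V)).
  split; first by exists 0; rewrite scale0r.
  by move=> c _ _ [c1 ->] [c2 ->]; exists (c * c1 + c2); rewrite scalerDl scalerA.
move=> b; move E : 0%N => d mb; case: mb E => [_|e b' p d' a' /bp_generator_gt1].
  by exists 1; rewrite scale1r.
by move=> ? _ ?; exfalso; lia.
Qed.

Lemma homogeneous_decomposition a : exists s : seq (nat * V),
  (forall p, p \in s -> bp_homogeneous p.1 p.2) /\ a = \sum_(p <- s) p.2.
Proof.
apply: (gen_V (P := fun a => exists s : seq (nat * V),
  (forall p, p \in s -> bp_homogeneous p.1 p.2) /\ a = \sum_(p <- s) p.2)).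
- split; first by exists [::]; rewrite big_nil.
  move=> c _ _ [s [hs ->]] [t [ht ->]].
  exists ([seq (p.1, c *: p.2) | p <- s] ++ t); split=> [p|].
    rewrite mem_cat => /orP[/mapP[q qs ->]|/ht//].
    by apply: subspaceZ (hs _ qs); apply: homogeneous_subspace.
  by rewrite big_cat big_map /= scaler_sumr.
- exists [:: (0%N, vac V)]; rewrite big_seq1; split=> // p.
  by rewrite inE => /eqP ->; apply: homogeneous_monomial; constructor.
- move=> b n _ Xb [s [hs ->]].
  have [e gb] : exists e, bp_generator e b.
    by case: Xb => ->; [exists 2%N|exists 4%N|exists 3%N|exists 3%N]; constructor.
  exists [seq (e + n.*2 + p.1, nprod b (- n.+1%:Z) p.2)%N | p <- s]; split.
    by move=> _ /mapP[q qs ->]; apply: homogeneous_cons => //; apply: hs.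
  rewrite big_map /= (@big_morph _ _ (nprod b (- n.+1%:Z)) 0 +%R) //.
    by move=> u v; rewrite (actDr nbil).
  by rewrite (act0r nbil).
Qed.

Lemma generator_T0 e b : bp_generator e b -> nprod (fT X) 0 b = transl b.
Proof.
by case; [rewrite (ope_TJ opes 0)|rewrite (ope_TT opes 0)
         |rewrite (ope_TGp opes 0)|rewrite (ope_TGm opes 0)].
Qed.

Lemma generator_T1 e b : bp_generator e b -> nprod (fT X) 1 b = (e%:R / 2) *: b.
Proof.
have two0 : (2 : C) != 0 by rewrite pnatr_eq0.
case; [rewrite (ope_TJ opes 1)|rewrite (ope_TT opes 1)
         |rewrite (ope_TGp opes 1)|rewrite (ope_TGm opes 1)] => //=.
  by rewrite divff // scale1r.
by rewrite (natrM C 2 2) mulfK.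
Qed.

(** The OPEs give this on generators only. It spreads along monomials because [[T_(0), b_(n)] =
    (T_(0) b)_(n)], and [transl] obeys the same Leibniz rule. *)
Lemma nprod_T0 a : nprod (fT X) 0 a = transl a.
Proof.
have bil := nprod_bilinear V.
apply: (gen_V (P := fun a => nprod (fT X) 0 a = transl a)).
- split; first by rewrite /transl (act0r bil) (act0l bil).
  by move=> c u v Tu Tv; rewrite bil.2 Tu Tv /transl bil.1.
- by rewrite (nprod_vacr0 0) /transl nprod_vacl.
- move=> b n u Xb Tu.
  have [e gb] : exists e, bp_generator e b.
    by case: Xb => ->; [exists 2%N|exists 4%N|exists 3%N|exists 3%N]; constructor.
  rewrite transl_nprod -Tu -[LHS](subrK (nprod b (- n.+1%:Z) (nprod (fT X) 0 u))).
  rewrite nprod_commutator fsum1 /=; last first.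
    by case=> // j _; rewrite binz0S scale0r.
  rewrite binz0 scale1r (generator_T0 gb) add0r subr0.
  by rewrite nprod_transl scaleNr addrC.
Qed.

Lemma mact_T1_commutator (M : vaModule V) d a n (w : M) :
  nprod (fT X) 1 a = d *: a ->
  mact (fT X) 1 (mact a n w) =
    mact a n (mact (fT X) 1 w) + (d - (n + 1)%:~R) *: mact a n w.
Proof.
move=> Ta; rewrite -[LHS](subrK (mact a n (mact (fT X) 1 w))) addrC mact_commutator.
rewrite (@fsumE _ _ 2); last by case=> [|[|j]] // _; rewrite (@binz_small _ 1) // scale0r.
rewrite !big_ord_recl big_ord0 addr0 /= nprod_T0 binz0 binz1 !scale1r Ta.
rewrite mact_transl (actZl (mact_bilinear M)) scalerBl addr0 scaleNr.
rewrite (_ : 1 + n - 1 = n); last by lia.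
by rewrite [1 + n]addrC [- _ + _]addrC.
Qed.

Lemma nprod_T1_commutator d a n (u : V) :
  nprod (fT X) 1 a = d *: a ->
  nprod (fT X) 1 (nprod a n u) =
    nprod a n (nprod (fT X) 1 u) + (d - (n + 1)%:~R) *: nprod a n u.
Proof. exact: (mact_T1_commutator (M := adjoint_module V)). Qed.

Lemma homogeneous_T1 d a : bp_homogeneous d a -> nprod (fT X) 1 a = (d%:R / 2) *: a.
Proof.
move=> ha; apply: (ha (fun a => nprod (fT X) 1 a = (d%:R / 2) *: a)).
  split; first by rewrite (act0r nbil) scaler0.
  by move=> c u v Tu Tv; rewrite nbil.2 Tu Tv scalerDr !scalerA mulrC.
move=> b; elim=> {d a ha b} [|e b p d a gb _ IH].
  by rewrite (nprod_vacr0 1) mul0r scale0r.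
rewrite (nprod_T1_commutator _ _ (generator_T1 gb)) IH (actZr nbil) -scalerDl.
congr (_ *: _); have -> : - p.+1%:Z + 1 = - p%:Z by lia.
rewrite rmorphN /= -pmulrn !natrD -muln2 natrM.
by field.
Qed.

(** The components of weight other than [z] add up to a [T_(1)]-eigenvector of eigenvalue [z / 2],
    so [eigen_elimination] kills their sum. Letting [z] be any integer makes negative weights a case
    of [a = 0]. *)
Lemma T1_homogeneous (z : int) a : nprod (fT X) 1 a = (z%:~R / 2) *: a ->
  a = 0 \/ exists2 d : nat, z = d%:Z & bp_homogeneous d a.
Proof.
move=> Ta; have [s [hs Ea]] := homogeneous_decomposition a.
pose t := [seq p <- s | p.1%:Z == z]; pose t' := [seq p <- s | p.1%:Z != z].
have Ett' : a = \sum_(p <- t) p.2 + \sum_(p <- t') p.2.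
  by rewrite Ea !big_filter (bigID (fun p => p.1%:Z == z)).
have Tlin c (u v : V) : nprod (fT X) 1 (c *: u + v) =
    c *: nprod (fT X) 1 u + nprod (fT X) 1 v by exact: nbil.2.
have Tt : nprod (fT X) 1 (\sum_(p <- t) p.2) = (z%:~R / 2) *: \sum_(p <- t) p.2.
  apply: (@subspace_sum _ _ (fun u => nprod (fT X) 1 u = (z%:~R / 2) *: u)).
    split; first by rewrite (act0r nbil) scaler0.
    by move=> c u v Tu Tv; rewrite nbil.2 Tu Tv scalerDr !scalerA mulrC.
  move=> p; rewrite mem_filter => /andP[/eqP <- /hs /homogeneous_T1].
  by rewrite -pmulrn.
have t'0 : \sum_(p <- t') p.2 = 0.
  pose s' := [seq (p.1%:R / 2 : C, p.2) | p <- t'].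
  have -> : \sum_(p <- t') p.2 = \sum_(p <- s') p.2 by rewrite big_map.
  apply: (@eigen_elimination _ _ (nprod (fT X) 1) _ (z%:~R / 2) s' Tlin
            (subspace_zero V)).
  - by move=> u ->; rewrite (act0r nbil).
  - move=> q /mapP[p]; rewrite mem_filter => /andP[pz /hs /homogeneous_T1 Tp] -> /=.
    split=> //; apply: contraNneq pz => /(mulIf _) E.
    by rewrite -(eqr_int C) -pmulrn E // invr_neq0 ?pnatr_eq0.
  - rewrite big_map /=; apply/eqP; rewrite subr_eq0; apply/eqP.
    have -> : \sum_(p <- t') p.2 = a - \sum_(p <- t) p.2 by rewrite Ett' addrC addKr.
    by rewrite (actDr nbil) (actNr nbil) Ta Tt scalerBr.
rewrite t'0 addr0 in Ett'.
case: (pselect (exists2 p, p \in s & p.1%:Z = z)) => [[p ps pz]|nz].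
  right; exists p.1 => //; rewrite Ett'; apply: subspace_sum.
    exact: homogeneous_subspace.
  move=> q; rewrite mem_filter => /andP[/eqP qz /hs].
  suff -> : p.1 = q.1 by []; apply/eqP; rewrite -eqz_nat qz; exact/eqP.
left; rewrite Ett' /t (_ : [seq p <- s | _] = [::]) ?big_nil //.
apply/eqP; rewrite -(negbK (_ == _)) -has_filter; apply/hasPn => p ps /=.
by apply/eqP => pz; apply: nz; exists p.
Qed.

Section LoweringModes.

Variables (M : vaModule V) (u : M).
Let bil := mact_bilinear M.
Let tr := @mact_truncated C V M.

(** The mode [b_(n)] shifts the [T_(1)]-eigenvalue by [e / 2 - n - 1]; the inequality says that the
    shift is negative. *)
Definition killed_by_lowering_modes :=
  forall e b (n : int), bp_generator e b -> e%:Z < 2 * n + 2 -> mact b n u = 0.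

(** Strong induction on the weight. In the iterate formula for [b_(-p-1) a'] the delicate terms
    apply a mode of [a'] after a mode [b_(j)] that does not lower. That mode of [a'] then lowers by
    itself, and the commutator involves only the [a'_(i) b], which are zero or homogeneous of weight
    below [d]. *)
Lemma lowering_modes_kill d a (n : int) : killed_by_lowering_modes ->
  bp_homogeneous d a -> d%:Z < 2 * n + 2 -> mact a n u = 0.
Proof.
move=> low; elim: {d}d.+1 {-2}d (ltnSn d) a n => // D IH d ltdD a n ha.
apply: (ha (fun a => d%:Z < 2 * n + 2 -> mact a n u = 0)).
  split; first by rewrite (act0l bil).
  by move=> c v w Hv Hw lt; rewrite bil.1 Hv // Hw // scaler0 addr0.
move=> {a ha} a0 ma0; case: ma0 ltdD => [_ lt|e b p d' a gb ma lt_D lt].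
  by rewrite mact_vac; case: eqP => // ?; lia.
have e1 := bp_generator_gt1 gb; have ha := homogeneous_monomial ma.
have s0 := subspace_zero M.
apply: (mact_iterate_closed s0) => j.
  by rewrite (IH d') ?(act0r bil) //; lia.
have [ltj|gej] := ltP e%:Z (2 * j%:Z + 2).
  by rewrite (low e) ?(act0r bil).
apply: (mact_swap_closed s0) => [|i].
  by rewrite (IH d') ?(act0r bil) //; lia.
have : nprod (fT X) 1 (nprod a i%:Z b) =
    ((d'%:Z + e%:Z - 2 * i%:Z - 2)%:~R / 2) *: nprod a i%:Z b.
  rewrite (nprod_T1_commutator _ _ (homogeneous_T1 ha)) (generator_T1 gb) (actZr nbil).
  rewrite -scalerDl; congr (_ *: _).
  by rewrite !rmorphB !rmorphD !rmorphM /= -!pmulrn; field.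
case/T1_homogeneous => [->|[d'' Ed'' hab]]; first exact: (act0l bil).
by apply: (IH d'' _ _ _ hab); lia.
Qed.

(* The submodule generated by [u] lies in strictly higher weights than [v]. *)
Lemma lowering_modes_irreducible (mu : C) (z : nat) (v : M) :
  irreducible M -> v <> 0 -> mact (fT X) 1 v = mu *: v ->
  killed_by_lowering_modes ->
  mact (fT X) 1 u = (mu + z.+1%:R / 2) *: u -> u = 0.
Proof.
move=> [_ irrM] v0 Tv low Tu.
(* The span of the vectors [a_(n) u]; by [mact_product_closed] it already absorbs products of
   modes. *)
pose N w := forall Q : M -> Prop, subspace Q -> (forall a n, Q (mact a n u)) -> Q w.
have sN : subspace N.
  split=> [Q sQ _|c x y Nx Ny Q sQ HQ]; first exact: subspace0.
  by apply: sQ.2; [apply: Nx | apply: Ny].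
have Nact a n : N (mact a n u) by move=> Q _; apply.
have modN : submodule N.
  split=> // a n w Nw; apply: (Nw (fun w => N (mact a n w))).
    split; first by rewrite (act0r bil); apply: subspace0.
    by move=> c x y Nx Ny; rewrite bil.2; apply: sN.2.
  move=> b m; apply: mact_product_closed => // i q; exact: Nact.
have Nu : N u by have := Nact (vac V) (-1); rewrite mact_vac eqxx.
have [/(_ u Nu) //|/(_ v) Nv] := irrM _ modN.
case: v0; pose E (w : M) := exists s : seq (C * M), (forall p, p \in s ->
   mact (fT X) 1 p.2 = p.1 *: p.2 /\ p.1 != mu) /\ w = \sum_(p <- s) p.2.
have sE : subspace E.
  split; first by exists [::]; rewrite big_nil.
  move=> c _ _ [s [hs ->]] [t [ht ->]].
  exists ([seq (p.1, c *: p.2) | p <- s] ++ t); split=> [p|].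
    rewrite mem_cat => /orP[/mapP[q qs ->]|/ht//] /=; have [Tq ?] := hs q qs.
    by rewrite (actZr bil) Tq !scalerA mulrC.
  by rewrite big_cat big_map /= scaler_sumr.
have [s [hs Ev]] : E v.
  apply: Nv => // a n; have [s [hs ->]] := homogeneous_decomposition a.
  have -> : mact (\sum_(p <- s) p.2) n u = \sum_(p <- s) mact p.2 n u.
    apply: (@big_morph _ _ (fun a => mact a n u) 0 +%R); last exact: (act0l bil).
    by move=> ? ?; rewrite (actDl bil).
  apply: subspace_sum => // p ps; have hp := hs p ps.
  have [lt|ge] := ltP p.1%:Z (2 * n + 2).
    by rewrite (lowering_modes_kill low hp lt); apply: subspace0.
  exists [:: (mu + z.+1%:R / 2 + (p.1%:R / 2 - (n + 1)%:~R), mact p.2 n u)].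
  rewrite big_seq1; split=> // _ /[!inE] /eqP -> /=; split.
    rewrite (mact_T1_commutator _ _ (homogeneous_T1 hp)) Tu (actZr bil).
    by rewrite -scalerDl.
  (* Twice the excess over [mu]: [z.+1] from [u], plus the shift of a mode that does not lower.
     Hence [q > 0]. *)
  pose q : int := z.+1%:Z + p.1%:Z - 2 * n - 2.
  rewrite (_ : _ + _ = mu + q%:~R / 2).
    rewrite -subr_eq0 addrC addKr mulf_neq0 ?invr_neq0 ?pnatr_eq0 // intr_eq0.
    by rewrite /q; lia.
  by rewrite /q !rmorphB !rmorphD !rmorphM /= -!pmulrn; field.
rewrite Ev; apply: (@eigen_elimination _ _ (mact (fT X) 1) _ mu s _ (subspace_zero M)).
- by move=> c x y; rewrite bil.2.
- by move=> x ->; rewrite (act0r bil).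
- exact: hs.
- by rewrite -Ev Tv subrr.
Qed.

End LoweringModes.

End BershadskyPolyakov.

(** * Highest weight modules at level -1 *)

Section Annihilators.

Variables (C : numFieldType) (V : vertexAlgebra C) (M : vaModule V).

Definition annihilates (a : V) := forall n (w : M), mact a n w = 0.

Lemma annihilates_ideal : va_ideal annihilates.
Proof.
have bil := mact_bilinear M; split.
  split; first by move=> n w; rewrite (act0l bil).
  by move=> c a b Ka Kb n w; rewrite bil.1 Ka Kb scaler0 addr0.
move=> a u n Ku; split=> m w.
  by apply: (mact_iterate_closed (subspace_zero M)) => j; rewrite ?Ku ?(act0r bil).
by apply: (mact_iterate_closed (subspace_zero M)) => j; rewrite ?Ku ?(act0r bil).
Qed.

(** The vectors killed by all modes of [u] form a submodule. With [N] such that [u_(i) a = 0] for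
    [i >= N], the Borcherds identity expresses [u_(n) a_(k) w] through vectors [u_(n-j) a_(k+j) w]
    with [j > 0]; truncation starts a descending induction on [k]. *)
Lemma generated_annihilates (v : M) (u : V) :
  generated_by v -> (forall n, mact u n v = 0) -> annihilates u.
Proof.
have bil := mact_bilinear M; have tr := @mact_truncated C V M.
move=> gen uv n w; move: w n; apply: (gen (fun w => forall n, mact u n w = 0)) => //.
split; first split=> [n|c w1 w2 H1 H2 n]; first by rewrite (act0r bil).
  by rewrite bil.2 H1 H2 scaler0 addr0.
move=> a k w uw n; have [K HK] := act_vanishes tr a w.
have [N HN] := act_vanishes (@nprod_truncated C V) u a.
have [d] : exists d : nat, K%:Z - d%:Z <= k by exists (K + `|k|)%N; lia.
elim: d k n => [|d IH] k n le.
  by rewrite [mact a k w]HK ?(act0r bil) //; lia.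
have := mact_borcherdsE u a (n - N%:Z) N%:Z k w; rewrite /left_sum /right_sum.
rewrite fsum0 => [|j]; last by rewrite HN ?(act0l bil) ?scaler0 //; lia.
rewrite fsum1 => [E|[|j] // _]; last first.
  by rewrite IH ?uw ?(act0r bil) ?scaler0 ?subr0 ?scaler0 //; lia.
move: E; rewrite uw (act0r bil) scaler0 subr0 expr0 binz0 mulr1 scale1r subrK.
by rewrite subr0 addr0 => <-.
Qed.

End Annihilators.

Section LeftIdeals.

Variables (C : numFieldType) (k : C) (V : vertexAlgebra C) (X : bpFields V).
Hypothesis opes : bp_opes k X.
Hypothesis gen_V :
  strongly_generates (fun a => [\/ a = fJ X, a = fT X, a = fGp X | a = fGm X]).

(** A left ideal is stable under [transl], which is [T_(0)], hence contains every [x_(q) vac] with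
    [x] in it. Writing [a = a_(-1) vac] and commuting [a_(-1)] past [u_(n)] then gives [u_(n) a]. *)
Lemma submodule_adjoint_ideal (P : V -> Prop) :
  @submodule C V (adjoint_module V) P -> va_ideal P.
Proof.
have bil := nprod_bilinear V.
move=> [sP actP]; split=> // a u n Pu; split; first exact: actP.
have Pvac x q : P x -> P (nprod x q (vac V)).
  case: (ltP q 0) => [q_neg|q_ge0]; last first.
    move=> _; have -> : q = `|q|%N%:Z by lia.
    by rewrite nprod_vacr0; apply: subspace0.
  have [i ->] : exists i : nat, q = - i.+1%:Z by exists `|(q + 1)%R|%N; lia.
  elim: i x => [|i IH] x Px; first by rewrite nprod_vacr.
  have PDx : P (transl x) by rewrite -(nprod_T0 opes gen_V); apply: actP.
  have := IH _ PDx; rewrite nprod_transl rmorphN /= opprK => H.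
  have -> : - i.+2%:Z = - i.+1%:Z - 1 by lia.
  by apply: subspaceZE H => //; rewrite -pmulrn pnatr_eq0.
rewrite -[a in nprod u n a]nprod_vacr.
apply: (@mact_swapr_closed _ _ (adjoint_module V) P sP a u (-1) n (vac V)) => /=.
  by apply: actP; apply: Pvac.
by move=> j; apply: Pvac; apply: actP.
Qed.

End LeftIdeals.

Section LevelMinusOne.

Variables (C : numFieldType) (V : vertexAlgebra C) (X : bpFields V).
Hypothesis opes : bp_opes (-1) X.
Hypothesis gen_V :
  strongly_generates (fun a => [\/ a = fJ X, a = fT X, a = fGp X | a = fGm X]).

Let nbil := nprod_bilinear V.
Local Notation J := (fJ X).
Local Notation T := (fT X).
Local Notation Gp := (fGp X).
Local Notation Gm := (fGm X).
Local Notation tau := (nprod (fGp X) 0 (fGm X)).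

Lemma tauE : tau = 3 *: nprod J (-1) J - 2 *: T.
Proof.
rewrite (ope_GpGm opes 0) /= addNr mulr0 mul0r scale0r addr0.
by congr (_ - _ *: _); ring.
Qed.

Lemma TE : T = (3 / 2) *: nprod J (-1) J - 2^-1 *: tau.
Proof.
rewrite tauE scalerBr !scalerA opprB [2^-1 * 3]mulrC addrC subrK mulVf ?scale1r //.
by rewrite pnatr_eq0.
Qed.

(** The poles of order two and three carry the factor [k + 1]; this is where the level -1 makes the
    commutator of [Gp] and [Gm] a single mode of [tau]. *)
Lemma nprod_GpS (j : nat) : nprod Gp j.+1%:Z Gm = 0.
Proof.
rewrite (ope_GpGm opes j.+1).
by case: j => [|[|j]] /=; rewrite ?nth_nil // addNr ?mul0r ?mulr0 scale0r.
Qed.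

Section Commutators.

Variable M : vaModule V.

Let bil := mact_bilinear M.

Lemma commutator_GpGm (m n : int) (w : M) :
  mact Gp m (mact Gm n w) - mact Gm n (mact Gp m w) = mact tau (m + n) w.
Proof.
rewrite mact_commutator fsum1; first by rewrite binz0 scale1r subr0.
by case=> // j _; rewrite nprod_GpS (act0l bil) scaler0.
Qed.

Lemma commutator_JJ (m n : int) (w : M) :
  mact J m (mact J n w) - mact J n (mact J m w) =
  if m + n == 0 then (m%:~R / 3) *: w else 0.
Proof.
rewrite mact_commutator (@fsumE _ _ 2); last first.
  by case=> [|[|j]] // _; rewrite (ope_JJ opes) /= nth_nil (act0l bil) scaler0.
rewrite !big_ord_recl big_ord0 !(ope_JJ opes) /= (act0l bil) scaler0 add0r addr0.
rewrite (actZl bil) mact_vac binz1 scalerA /bump /= addn0.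
have -> : (m + n - 1 == -1) = (m + n == 0) by apply/eqP/eqP; lia.
case: eqP => _; last by rewrite scaler0.
by congr (_ *: _); congr (_ * _); rewrite -[RHS]mul1r; congr (_ / _); ring.
Qed.

Variables (x y : C) (v : M).

(** Stated for a bare vector, to serve both highest weight vectors and the vacuum in the twisted
    module. *)
Lemma mact_JJ (q : int) :
  (forall n : int, 0 < n -> mact J n v = 0) -> mact J 0 v = x *: v -> 0 < q ->
  mact (nprod J (-1) J) q v = if q == 1 then (x ^+ 2) *: v else 0.
Proof.
move=> HJ HJ0 q0; rewrite mact_iterate fsum1 => [|j j1]; last first.
  by rewrite !HJ ?(act0r bil) ?scaler0 ?subr0 ?scaler0 //; lia.
rewrite expr0 binz0 mulr1 scale1r [mact J (q + _) v]HJ ?(act0r bil) ?addr0 // sub0r.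
rewrite HJ0 (actZr bil) (_ : (-1) ^ (-1) = -1 :> C); last by rewrite /exprz /= invrN1.
rewrite scaleN1r opprK; case: eqP => [->|qn1].
  by rewrite addNr HJ0 scalerA.
by rewrite HJ ?scaler0 //; lia.
Qed.

Hypothesis hw : highest_weight_vector X x y v.

Lemma hw_J (n : int) : 0 < n -> mact J n v = 0.
Proof. by case: hw => _ _ _ H n1; have [] := H n n1. Qed.

Lemma hw_J0 : mact J 0 v = x *: v.
Proof. by case: hw. Qed.

Lemma hw_T (n : int) : 1 < n -> mact T n v = 0.
Proof.
case: hw => _ _ _ H n1; have [] := H (n - 1); first by lia.
move=> HJ; rewrite /Lmode subrK => HL _ _; move: HL HJ; rewrite /Jmode => + HJ.
by rewrite HJ scaler0 subr0.
Qed.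

Lemma hw_T1 : mact T 1 v = (y + x / 2) *: v.
Proof.
case: hw => _ HJ HL _; move: HL HJ; rewrite /Lmode /Jmode add0r => HL HJ.
move: HL; rewrite HJ scalerA mul1r => /eqP; rewrite subr_eq => /eqP ->.
by rewrite -scalerDl mulrC.
Qed.

Lemma hw_Gp (n : int) : 0 < n -> mact Gp n v = 0.
Proof. by case: hw => _ _ _ H n1; have [] := H n n1. Qed.

Lemma hw_Gm (n : int) : 0 < n -> mact Gm n v = 0.
Proof.
case: hw => _ _ _ H n1; have [_ _ _] := H n n1.
by rewrite /Gmmode subrK.
Qed.

Lemma hw_tau (q : int) : 0 < q -> mact tau q v = if q == 1 then - h1 x y *: v else 0.
Proof.
move=> q0; rewrite tauE (actDl bil) (actNl bil) !(actZl bil) (mact_JJ hw_J hw_J0) //.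
case: eqP => [->|qn1]; last by rewrite hw_T ?scaler0 ?subrr //; lia.
rewrite hw_T1 !scalerA -scalerBl; by congr (_ *: _); rewrite /h1; field.
Qed.

End Commutators.

Lemma generator3 b : bp_generator X 3 b -> b = Gp \/ b = Gm.
Proof. by move E : 3%N => e gb; case: gb E => // _; [left|right]. Qed.

(* Inductively [Gp_(-N) v] and [Gm_(-N) v] are killed by all lowering modes,
   hence vanish: the only commutator that is not obviously zero on [v] is
   [tau = [Gp, Gm]], which for [N = 0] is the hypothesis [h1 x y = 0] and for
   [N > 0] is again a commutator of modes already known to kill [v]. *)
Lemma hw_G_vanish (M : vaModule V) x y (v : M) : irreducible M ->
  highest_weight_vector X x y v -> h1 x y = 0 ->
  forall n, mact Gp n v = 0 /\ mact Gm n v = 0.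
Proof.
have bil := mact_bilinear M; have s0 := subspace_zero M.
move=> irr hw h0.
suff H (N : nat) (n : int) : 1 - N%:Z <= n -> mact Gp n v = 0 /\ mact Gm n v = 0.
  by move=> n; apply: (H (1 + `|n|)%N); lia.
elim: N n => [|N IH] n le; first by rewrite (hw_Gp hw) ?(hw_Gm hw) //; lia.
have [/IH //|lt] := leP (1 - N%:Z) n.
have {le lt} -> : n = - N%:Z by lia.
have kill (q : int) : - N%:Z < q -> mact Gp q v = 0 /\ mact Gm q v = 0.
  by move=> ?; apply: IH; lia.
have taukill (q : int) : - N%:Z < q -> mact tau q v = 0.
  case: N {IH} kill => [|N] kill lt.
    by rewrite (hw_tau hw) // h0 oppr0 scale0r if_same.
  have [Gp0 _] := kill 0 isT; have [_ Gmq] := kill q lt.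
  by have := commutator_GpGm 0 q v; rewrite Gp0 Gmq !(act0r bil) subr0 add0r.
have [v0 _ _ _] := hw.
(* A field of weight 3/2 in mode [-N] raises the eigenvalue by [N + 1/2], so
   [lowering_modes_irreducible] applies with [z = N.*2]. *)
have weight b : bp_generator X 3 b -> mact T 1 (mact b (- N%:Z) v) =
    (y + x / 2 + N.*2.+1%:R / 2) *: mact b (- N%:Z) v.
  move=> gb; rewrite (mact_T1_commutator opes gen_V _ _ (generator_T1 opes gb)).
  rewrite (hw_T1 hw) (actZr bil) -scalerDl; congr (_ *: _).
  have -> : N.*2.+1%:R = N%:R * 2 + 1 :> C by rewrite -muln2 -natrM natr1.
  by rewrite rmorphD rmorphN /= -!pmulrn; field.
have low b : bp_generator X 3 b -> (forall q : int, - N%:Z < q -> mact b q v = 0) ->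
    (forall q : int, 0 < q -> mact Gp q (mact b (- N%:Z) v) = 0) ->
    (forall q : int, 0 < q -> mact Gm q (mact b (- N%:Z) v) = 0) ->
    killed_by_lowering_modes X (mact b (- N%:Z) v).
  move=> gb kb Hp Hm e c q; case=> lt; [| |by apply: Hp; lia|by apply: Hm; lia].
    apply: (mact_swap_closed s0) => [|[|j]]; first by rewrite (hw_J hw) ?(act0r bil) //; lia.
      have [z ->] : exists z, nprod J 0 b = z *: b.
        case: (generator3 gb) => ->; [rewrite (ope_JGp opes 0)|rewrite (ope_JGm opes 0)].
          by exists 1; rewrite scale1r.
        by exists (-1); rewrite scaleN1r.
      by rewrite (actZl bil) kb ?scaler0 //; lia.
    have -> : nprod J j.+1%:Z b = 0.
      by case: (generator3 gb) => ->; [rewrite (ope_JGp opes)|rewrite (ope_JGm opes)];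
        rewrite /= nth_nil.
    exact: (act0l bil).
  apply: (mact_swap_closed s0) => [|[|[|j]]]; first by rewrite (hw_T hw) ?(act0r bil) //; lia.
  - rewrite (generator_T0 opes gb) mact_transl kb ?scaler0 //; lia.
  - rewrite (generator_T1 opes gb) (actZl bil) kb ?scaler0 //; lia.
  - have -> : nprod T j.+2%:Z b = 0.
      by case: (generator3 gb) => ->; [rewrite (ope_TGp opes)|rewrite (ope_TGm opes)];
        rewrite /= nth_nil.
    exact: (act0l bil).
have vanish b : bp_generator X 3 b -> (forall q : int, - N%:Z < q -> mact b q v = 0) ->
    (forall q : int, 0 < q -> mact Gp q (mact b (- N%:Z) v) = 0) ->
    (forall q : int, 0 < q -> mact Gm q (mact b (- N%:Z) v) = 0) ->
    mact b (- N%:Z) v = 0.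
  move=> gb kb Hp Hm.
  apply: (lowering_modes_irreducible opes gen_V irr v0 (hw_T1 hw)); last exact: weight.
  exact: low.
split; apply: vanish; try constructor; move=> q q0; try by have [] := kill q q0.
- apply: (mact_swap_closed s0) => [|j]; first by rewrite (hw_Gp hw) ?(act0r bil).
  by rewrite (ope_GpGp opes) nth_nil (act0l bil).
- have [_ Gm0] : mact Gp q v = 0 /\ mact Gm q v = 0 by apply: kill; lia.
  have := commutator_GpGm (- N%:Z) q v; rewrite Gm0 (act0r bil) sub0r.
  by rewrite taukill ?oppr0 => [/eqP|]; [rewrite oppr_eq0 => /eqP|lia].
- have [Gp0 _] : mact Gp q v = 0 /\ mact Gm q v = 0 by apply: kill; lia.
  have := commutator_GpGm q (- N%:Z) v; rewrite Gp0 (act0r bil) subr0 => ->.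
  by apply: taukill; lia.
- apply: (mact_swap_closed s0) => [|j]; first by rewrite (hw_Gm hw) ?(act0r bil).
  by rewrite (ope_GmGm opes) nth_nil (act0l bil).
Qed.

End LevelMinusOne.

(** * Ideals and the simple quotient *)

(** The degree [d] is the induction measure for the maximality of [I]. For [I = 0] the filtration
    expresses the local nilpotency that makes Li's exponential finite. *)
Fixpoint annihilation_filtration (C : numFieldType) (V : vertexAlgebra C) (h : V)
    (I : V -> Prop) (d : nat) (a : V) : Prop :=
  if d is d'.+1 then
    forall i : nat, annihilation_filtration h I d' (nprod h i.+1%:Z a)
  else I a.

Section IdealsLevelMinusOne.

Variables (C : numFieldType) (V : vertexAlgebra C) (X : bpFields V).
Hypothesis opes : bp_opes (-1) X.
Hypothesis gen_V :
  strongly_generates (fun a => [\/ a = fJ X, a = fT X, a = fGp X | a = fGm X]).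

Let nbil := nprod_bilinear V.
Local Notation J := (fJ X).
Local Notation T := (fT X).
Local Notation tau := (nprod (fGp X) 0 (fGm X)).

Lemma nprod_commutator_JJ (m n : int) (a : V) :
  nprod J m (nprod J n a) - nprod J n (nprod J m a) =
  if m + n == 0 then (m%:~R / 3) *: a else 0.
Proof. exact: (commutator_JJ opes (M := adjoint_module V)). Qed.

Lemma nprod_swapJ (m n : int) (a : V) :
  nprod J m (nprod J n a) = nprod J n (nprod J m a) +
  if m + n == 0 then (m%:~R / 3) *: a else 0.
Proof. by rewrite -nprod_commutator_JJ addrC subrK. Qed.

Lemma nprod_iterate_closed (P : V -> Prop) (a b u : V) (n q : int) : subspace P ->
  (forall j : nat, P (nprod a (n - j%:Z) (nprod b (q + j%:Z) u))) ->
  (forall j : nat, P (nprod b (n + q - j%:Z) (nprod a j%:Z u))) ->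
  P (nprod (nprod a n b) q u).
Proof. by move=> sP; apply: (mact_iterate_closed (M := adjoint_module V) sP). Qed.

Variable I : V -> Prop.
Hypothesis idI : va_ideal I.
Hypotheses (IGp : I (fGp X)) (IGm : I (fGm X)).

Let sI : subspace I := proj1 idI.

Lemma idealL a u n : I u -> I (nprod a n u).
Proof. by case: idI => _ H /(H a u n) []. Qed.

Lemma idealR a u n : I u -> I (nprod u n a).
Proof. by case: idI => _ H /(H a u n) []. Qed.

Lemma J_induction (P : V -> Prop) : subspace P -> (forall a, I a -> P a) ->
  P (vac V) -> (forall n a, P a -> P (nprod J n a)) -> forall a, P a.
Proof.
move=> sP IP Pvac PJ a; apply: gen_V => // b n u Xb Pu.
case: Xb => ->; first exact: PJ.
- rewrite (TE opes) (actDl nbil) (actNl nbil) !(actZl nbil).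
  apply: subspaceB => //; apply: subspaceZ => //.
    by apply: nprod_iterate_closed => // j; exact: (PJ _ _ (PJ _ _ Pu)).
  by apply: IP; apply: idealR; apply: idealR.
- by apply: IP; apply: idealR.
- by apply: IP; apply: idealR.
Qed.

(** The mode [J_(0)] commutes with all modes of [J] and kills the vacuum. For the zero ideal of the
    quotient this is the hypothesis [h0] of the twist. *)
Lemma ideal_J0 a : I (nprod J 0 a).
Proof.
apply: (J_induction (P := fun a => I (nprod J 0 a))) => [|u||n u].
- split; first by rewrite (act0r nbil); apply: subspace0.
  by move=> c u v Iu Iv; rewrite nbil.2; apply: sI.2.
- exact: idealL.
- by rewrite (nprod_vacr0 0); apply: subspace0.
- move=> Iu; rewrite nprod_swapJ mul0r scale0r if_same addr0; exact: idealL.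
Qed.

Local Notation J_filtration := (annihilation_filtration J I).

Lemma J_filtration_subspace d : subspace (J_filtration d).
Proof.
elim: d => [|d IH] //=; split=> [i|c u v Fu Fv i].
  by rewrite (act0r nbil); apply: subspace0.
by rewrite nbil.2; apply: IH.2.
Qed.

Lemma J_filtrationS d a : J_filtration d a -> J_filtration d.+1 a.
Proof.
elim: d a => [|d IH] a /= Fa i; first exact: idealL.
by apply: IH.
Qed.

Lemma J_filtration_le d d' a : (d <= d')%N -> J_filtration d a -> J_filtration d' a.
Proof.
move=> /subnK <-; elim: (d' - d)%N => // m IH /IH; rewrite addSn.
exact: J_filtrationS.
Qed.

(** Modes of [J] commute up to scalars, so moving the positive modes past [J_(n)] costs at most one
    more of them. *)
Lemma J_filtrationJ d a n : J_filtration d a -> J_filtration d.+1 (nprod J n a).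
Proof.
elim: d a n => [|d IH] a n Fa; first by move=> i /=; do 2!apply: idealL.
move=> i; rewrite nprod_swapJ; have sF := J_filtration_subspace d.+1.
apply: (subspaceD sF); first by apply: IH; apply: Fa.
by case: eqP => _; [apply: (subspaceZ sF) | apply: (subspace0 sF)].
Qed.

Lemma J_filtration_exhausts a : exists d, J_filtration d a.
Proof.
apply: (J_induction (P := fun a => exists d, J_filtration d a)) => [|u Iu||n u [d Fu]].
- split; first by exists 0%N; apply: subspace0.
  move=> c u v [d Fu] [d' Fv]; exists (maxn d d').
  by apply: (J_filtration_subspace _).2; [apply: J_filtration_le Fu; rewrite leq_maxl
    | apply: J_filtration_le Fv; rewrite leq_maxr].
- by exists 0%N.
- by exists 1%N => i; rewrite nprod_vacr0; apply: subspace0.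
- by exists d.+1; apply: J_filtrationJ.
Qed.

(** Generators have positive weight, so the component of weight 0 is a multiple of the vacuum. *)
Lemma vac_decomposition a : exists (c : C) (s : seq (C * V)),
  (forall p, p \in s -> nprod T 1 p.2 = p.1 *: p.2 /\ p.1 != 0) /\
  a = c *: vac V + \sum_(p <- s) p.2.
Proof.
have [s [hs ->]] := homogeneous_decomposition gen_V a.
have [c Ec] : exists c : C, \sum_(p <- s | p.1 == 0%N) p.2 = c *: vac V.
  rewrite -big_filter; apply: homogeneous0; apply: subspace_sum.
    exact: homogeneous_subspace.
  by move=> p; rewrite mem_filter => /andP[/eqP <-]; apply: hs.
exists c, [seq (p.1%:R / 2, p.2) | p <- s & p.1 != 0%N]; split.
  move=> q /mapP[p]; rewrite mem_filter => /andP[p0 /hs hp] -> /=; split.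
    exact: (homogeneous_T1 opes gen_V).
  by rewrite mulf_neq0 ?invr_neq0 ?pnatr_eq0.
by rewrite big_map big_filter (bigID (fun p => p.1 == 0%N)) /= Ec.
Qed.

Lemma T1_elimination (s : seq (C * V)) (K : V -> Prop) : va_ideal K ->
  (forall p, p \in s -> nprod T 1 p.2 = p.1 *: p.2 /\ p.1 != 0) ->
  K (nprod T 1 (\sum_(p <- s) p.2)) -> K (\sum_(p <- s) p.2).
Proof.
move=> [sK KL] hs KT; apply: (@eigen_elimination _ _ (nprod T 1) _ 0 s) => //.
- by move=> c u v; rewrite nbil.2.
- by move=> u /(KL T u 1) [].
- by rewrite scale0r subr0.
Qed.

Lemma T1_vac c (u : V) : nprod T 1 (c *: vac V + u) = nprod T 1 u.
Proof. by rewrite nbil.2 (nprod_vacr0 1) scaler0 add0r. Qed.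

(* Modulo [I], [T_1 = (3/2) (J_0 J_0 + 2 sum_(i > 0) J_(-i) J_i)]. *)
Lemma J_singular a : (forall i : nat, I (nprod J i.+1%:Z a)) ->
  exists c : C, I (a - c *: vac V).
Proof.
move=> IJa; have [c [s [hs Ea]]] := vac_decomposition a.
exists c; rewrite Ea addrC addKr; apply: T1_elimination => //.
rewrite -(T1_vac c) -Ea (TE opes) (actDl nbil) (actNl nbil) !(actZl nbil).
apply: subspaceB => //; apply: subspaceZ => //; last by apply: idealR; apply: idealR.
apply: nprod_iterate_closed => // j.
  have -> : 1 + j%:Z = j.+1%:Z by lia.
  exact: idealL.
by apply: idealL; case: j => [|j]; [apply: ideal_J0 | apply: IJa].
Qed.

(** An element of a proper ideal has no vacuum component: elimination puts its other part into [I],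
    hence [c *: vac V] as well. So [a] is a sum of vectors of nonzero weight, and
    [T_(1) a = - T_(1) (vac - a)] lies in [K]; elimination puts [a], and therefore the vacuum, into
    [K]. *)
Lemma proper_ideals_comaximal (K : V -> Prop) : va_ideal K ->
  ~ I (vac V) -> ~ K (vac V) -> forall a, I a -> ~ K (vac V - a).
Proof.
move=> idK nI nK a Ia Kva; have [sK _] := idK.
have [c [s [hs Ea]]] := vac_decomposition a.
have Is : I (\sum_(p <- s) p.2).
  by apply: T1_elimination => //; rewrite -(T1_vac c) -Ea; apply: idealL.
have c0 : c = 0.
  apply/eqP/negPn/negP => c0; apply: nI; apply: (subspaceZE sI c0).
  by apply: (subspaceDE sI Is); rewrite -Ea.
rewrite c0 scale0r add0r in Ea; apply: nK.
rewrite -(subrK a (vac V)); apply: subspaceD => //.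
rewrite Ea; apply: T1_elimination => //; rewrite -Ea.
have -> : nprod T 1 a = - nprod T 1 (vac V - a).
  by rewrite (actDr nbil) (nprod_vacr0 1) add0r (actNr nbil) opprK.
by apply: subspaceN => //; case: idK => _ /(_ T _ 1 Kva) [].
Qed.

(** Induction on the filtration degree: the [J_(i+1) a] lie in [K] and have smaller degree, so they
    lie in [I], and [J_singular] makes [a] a multiple of the vacuum modulo [I]. As [K] is proper,
    that multiple is zero. *)
Lemma ideal_maximal (K : V -> Prop) : va_ideal K ->
  (forall a, I a -> K a) -> ~ K (vac V) -> forall a, K a -> I a.
Proof.
move=> idK IK nK a; have [d] := J_filtration_exhausts a; have [sK KL] := idK.
elim: d a => [|d IH] a //= Fa Ka.
have [c Ic] : exists c : C, I (a - c *: vac V).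
  by apply: J_singular => i; apply: IH; [exact: Fa | case: (KL J a i.+1%:Z Ka)].
have [c0|c0] := eqVneq c 0; first by move: Ic; rewrite c0 scale0r subr0.
case: nK; apply: (subspaceZE sK c0); rewrite -(subKr a (c *: vac V)).
by rewrite subKr; have := subspaceB sK Ka (IK _ Ic); rewrite opprB addrC subrK.
Qed.

End IdealsLevelMinusOne.

(** * Pullbacks, images and factorization along a surjective homomorphism *)

Section Quotients.

Variables (C : numFieldType) (W S : vertexAlgebra C) (pi : W -> S).
Hypothesis hom_pi : va_hom pi.

Let pi_lin c a b : pi (c *: a + b) = c *: pi a + pi b.
Proof. by case: hom_pi. Qed.

Let pi_nprod a n b : pi (nprod a n b) = nprod (pi a) n (pi b).
Proof. by case: hom_pi. Qed.

Lemma va_hom0 : pi 0 = 0.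
Proof. by have := pi_lin (-1) 0 0; rewrite scaler0 addr0 scaleN1r addNr. Qed.

Lemma va_homZ c a : pi (c *: a) = c *: pi a.
Proof. by rewrite -[c *: a]addr0 pi_lin va_hom0 addr0. Qed.

Lemma va_homD a b : pi (a + b) = pi a + pi b.
Proof. by rewrite -[a]scale1r pi_lin !scale1r. Qed.

Lemma va_homN a : pi (- a) = - pi a.
Proof. by rewrite -scaleN1r va_homZ scaleN1r. Qed.

Lemma va_hom_transl a : pi (transl a) = transl (pi a).
Proof. by rewrite /transl pi_nprod; case: hom_pi => _ ->. Qed.

Lemma kernel_ideal : va_ideal (fun a => pi a = 0).
Proof.
split; first by split=> [|c u v Hu Hv]; rewrite ?va_hom0 // pi_lin Hu Hv scaler0 addr0.
move=> a u n Hu; rewrite !pi_nprod Hu (act0r (nprod_bilinear S)).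
by rewrite (act0l (nprod_bilinear S)).
Qed.

Section Pullback.

Variable N : vaModule S.

Definition pullback_act (a : W) (n : int) (w : N) := mact (pi a) n w.

Lemma pullback_bilinear : bilinear_modes pullback_act.
Proof.
have bil := mact_bilinear N.
by split=> [n w c a b|a n c u w]; rewrite /pullback_act ?pi_lin ?bil.1 ?bil.2.
Qed.

Lemma pullback_truncated : truncated_modes pullback_act.
Proof. by move=> a w; apply: mact_truncated. Qed.

Lemma pullback_vac n w : pullback_act (vac W) n w = if n == -1 then w else 0.
Proof. by rewrite /pullback_act; case: hom_pi => _ -> _; apply: mact_vac. Qed.

Lemma pullback_borcherds : borcherds (@nprod C W) pullback_act.
Proof.
move=> a b m n k w; have [N0 H] := mact_borcherds (pi a) (pi b) m n k w.
exists N0 => M /H {}H; rewrite /pullback_act -H.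
by apply: eq_bigr => j _; rewrite pi_nprod.
Qed.

Definition pullback_module : vaModule W :=
  VaModule pullback_bilinear pullback_truncated pullback_vac pullback_borcherds.

End Pullback.

Hypothesis surj_pi : forall s, exists a, pi a = s.

Lemma image_ideal (I : W -> Prop) : va_ideal I ->
  va_ideal (fun s => exists2 a, I a & pi a = s).
Proof.
move=> [sI IL]; split.
  split; first by exists 0; [apply: subspace0 | apply: va_hom0].
  move=> c _ _ [a Ia <-] [b Ib <-]; exists (c *: a + b) => //; exact: sI.2.
move=> s _ n [u Iu <-]; have [a <-] := surj_pi s; have [I1 I2] := IL a u n Iu.
by split; [exists (nprod a n u) | exists (nprod u n a)].
Qed.

Lemma factors_through_kernel (M : vaModule W) :
  (forall a, pi a = 0 -> annihilates M a) -> factors_through pi M.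
Proof.
have bil := mact_bilinear M; move=> kerM.
pose sec s := sval (cid (surj_pi s)).
have secK s : pi (sec s) = s := svalP (cid (surj_pi s)).
have well a b n (w : M) : pi a = pi b -> mact a n w = mact b n w.
  move=> E; apply/eqP; rewrite -subr_eq0 -(actNl bil) -(actDl bil); apply/eqP.
  by apply: kerM; rewrite va_homD va_homN E subrr.
exists (fun s n w => mact (sec s) n w); split.
- split=> [n w c s t|s n c u w]; last by rewrite bil.2.
  by rewrite -bil.1; apply: well; rewrite pi_lin !secK.
- by move=> s w; apply: mact_truncated.
- move=> n w; rewrite -(mact_vac n w); apply: well; rewrite secK.
  by case: hom_pi.
- move=> s t m n k w; have [N0 H] := mact_borcherds (sec s) (sec t) m n k w.
  exists N0 => N /H {}H; rewrite -H; apply: eq_bigr => j _; congr (_ *: _).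
  by apply: well; rewrite pi_nprod !secK.
- by move=> a n w; apply: well; rewrite secK.
Qed.

Variables (k : C) (X : bpFields W).
Hypothesis bpX : bp_algebra k X.

Definition image_fields : bpFields S :=
  BPFields (pi (fJ X)) (pi (fT X)) (pi (fGp X)) (pi (fGm X)).

Lemma ope_image a b s : ope a b s -> ope (pi a) (pi b) [seq pi c | c <- s].
Proof.
move=> H n; rewrite -pi_nprod H; have [lt|ge] := ltnP n (size s).
  by rewrite (nth_map 0).
by rewrite !nth_default ?size_map // va_hom0.
Qed.

Lemma image_bp_algebra : bp_algebra k image_fields.
Proof.
have pi_vac : pi (vac W) = vac S by case: hom_pi.
case: bpX => [[H1 H2 H3 H4 H5 H6 H7 H8 H9 H10] gen]; split.
  split.
  - by have := ope_image H1; rewrite /= va_hom0 va_homZ pi_vac.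
  - exact: (ope_image H2).
  - exact: (ope_image H3).
  - exact: (ope_image H4).
  - by have := ope_image H5; rewrite /= va_homN.
  - by have := ope_image H6; rewrite /= va_hom_transl !va_homZ va_hom0 pi_vac.
  - by have := ope_image H7; rewrite /= va_hom_transl va_homZ.
  - by have := ope_image H8; rewrite /= va_hom_transl va_homZ.
  - by have := ope_image H9; rewrite /= va_hom_transl.
  - have := ope_image H10.
    by rewrite /= !(va_homD, va_homN, va_homZ, pi_nprod, va_hom_transl) pi_vac.
move=> P sP Pvac PX s; have [a <-] := surj_pi s.
apply: (gen (fun a => P (pi a))).
- split; first by rewrite va_hom0; exact: subspace0.
  by move=> c u v Pu Pv; rewrite pi_lin; apply: sP.2.
- by rewrite pi_vac.
- move=> b n u Xb Pu; rewrite pi_nprod; apply: PX => //.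
  by case: Xb => ->; [apply: Or41|apply: Or42|apply: Or43|apply: Or44].
Qed.

End Quotients.

(** * Li's twist *)

Lemma binz_bin (C : numFieldType) (i j : nat) : binz C i%:Z j = 'C(i, j)%:R.
Proof.
elim: j => [|j IH]; first by rewrite binz0 bin0.
apply: (@mulIf _ j.+1%:R); first by rewrite pnatr_eq0.
rewrite binzS IH -natrM [in RHS]mulnC mul_bin_left natrM mulrC.
have [le|lt] := leqP j i; last by rewrite bin_small ?mulr0.
by rewrite subzn // -pmulrn.
Qed.

Lemma scaler_pull (R : comPzRingType) (U : lmodType R) (c d e : R) (u v : U) :
  d *: (c *: u - e *: (c *: v)) = c *: (d *: (u - e *: v)).
Proof. by rewrite [e *: (c *: v)]scalerA [e * c]mulrC -scalerA -scalerBr !scalerA mulrC. Qed.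

(** * Linearity of both sides of the Borcherds identity in the action *)

Section SumsOfActions.

Variables (C : numFieldType) (V : vertexAlgebra C) (M : lmodType C).
Implicit Types f g : V -> int -> M -> M.

Lemma left_sumZ f a b m n k w (c : C) : bilinear_modes f ->
  left_sum (fun a q w => c *: f a q w) a b m n k w = c *: left_sum f a b m n k w.
Proof.
move=> bil; rewrite /left_sum -fsumZ; last exact: (left_sum_finsupp bil).
by apply: fsum_ext => j; rewrite !scalerA mulrC.
Qed.

Lemma left_sum_fsum (F : nat -> V -> int -> M -> M) a b m n k w :
  (forall i, bilinear_modes (F i)) ->
  (forall a, exists L, forall i q w, (L <= i)%N -> F i a q w = 0) ->
  left_sum (fun a q w => fsum (fun i => F i a q w)) a b m n k w =
  fsum (fun i => left_sum (F i) a b m n k w).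
Proof.
move=> bil fin; rewrite /left_sum; have [N HN] := nprod_finsupp a b n.
rewrite -(fsum_exchange (F := fun j i => binz C m j *:
   F i (nprod a (n + j%:Z) b) (m + k - j%:Z) w)).
- apply: fsum_ext => j; rewrite fsumZ //.
  by have [L HL] := fin (nprod a (n + j%:Z) b); exists L => i /HL.
- by exists N => j i /HN ->; rewrite (act0l (bil i)) scaler0.
- move=> j; have [L HL] := fin (nprod a (n + j%:Z) b); exists L => i /HL ->.
  by rewrite scaler0.
Qed.

Variables f g : V -> int -> M -> M.
Hypotheses (bilf : bilinear_modes f) (bilg : bilinear_modes g).
Hypotheses (trf : truncated_modes f) (trg : truncated_modes g).

Lemma right_sumZl a b m n k w (c : C) :
  right_sum (fun a q w => c *: f a q w) g a b m n k w = c *: right_sum f g a b m n k w.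
Proof.
rewrite /right_sum -fsumZ; last exact: (right_sum_finsupp bilf trf bilg trg).
by apply: fsum_ext => j; rewrite (actZr bilg) scaler_pull.
Qed.

Lemma right_sumZr a b m n k w (c : C) :
  right_sum f (fun a q w => c *: g a q w) a b m n k w = c *: right_sum f g a b m n k w.
Proof.
rewrite /right_sum -fsumZ; last exact: (right_sum_finsupp bilf trf bilg trg).
by apply: fsum_ext => j; rewrite (actZr bilf) scaler_pull.
Qed.

Lemma right_sum0l a b m n k w : (forall q w, f a q w = 0) ->
  right_sum f g a b m n k w = 0.
Proof.
move=> fa; apply: fsum0 => j.
by rewrite !fa (act0r bilg) scaler0 subr0 scaler0.
Qed.

Lemma right_sum0r a b m n k w : (forall q w, g b q w = 0) ->
  right_sum f g a b m n k w = 0.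
Proof.
move=> gb; apply: fsum0 => j.
by rewrite !gb (act0r bilf) scaler0 subr0 scaler0.
Qed.

Lemma right_sum_fsuml (F : nat -> V -> int -> M -> M) a b m n k w :
  (forall i, bilinear_modes (F i)) -> (forall i, truncated_modes (F i)) ->
  (exists L, forall i q w, (L <= i)%N -> F i a q w = 0) ->
  right_sum (fun a q w => fsum (fun i => F i a q w)) g a b m n k w =
  fsum (fun i => right_sum (F i) g a b m n k w).
Proof.
move=> bil tr [L HL]; rewrite /right_sum.
have fin q u : finsupp (fun i => F i a q u) by exists L => i /HL.
rewrite fsum_exchange.
- apply: fsum_ext => j; rewrite fsumZ; last first.
    by exists L => i lei; rewrite !HL // (act0r bilg) scaler0 subr0.
  congr (_ *: _).
    rewrite fsumD //; last first.
      by exists L => i /HL ->; rewrite (act0r bilg) scaler0 oppr0.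
    congr (_ + _); rewrite (@fsum_additive _ _ (g b (n + k - j%:Z))) //; last first.
      exact: (actDr bilg).
    rewrite -fsumZ; last by exists L => i /HL ->; rewrite (act0r bilg).
    rewrite (@fsum_additive _ _ -%R) //; first exact: opprD.
    by exists L => i /HL ->; rewrite (act0r bilg) scaler0.
- by exists L => i j lei; rewrite !HL // (act0r bilg) scaler0 subr0 scaler0.
- by move=> i; apply: (right_sum_finsupp (bil i) (tr i) bilg trg).
Qed.

Lemma right_sum_fsumr (G : nat -> V -> int -> M -> M) a b m n k w :
  (forall i, bilinear_modes (G i)) -> (forall i, truncated_modes (G i)) ->
  (exists L, forall i q w, (L <= i)%N -> G i b q w = 0) ->
  right_sum f (fun a q w => fsum (fun i => G i a q w)) a b m n k w =
  fsum (fun i => right_sum f (G i) a b m n k w).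
Proof.
move=> bil tr [L HL]; rewrite /right_sum.
have fin q u : finsupp (fun i => G i b q u) by exists L => i /HL.
rewrite fsum_exchange.
- apply: fsum_ext => j; rewrite fsumZ; last first.
    by exists L => i lei; rewrite !HL // (act0r bilf) scaler0 subr0.
  congr (_ *: _).
    rewrite fsumD; last first.
    + by exists L => i /HL ->; rewrite scaler0 oppr0.
    + by exists L => i /HL ->; rewrite (act0r bilf).
    congr (_ + _).
      by rewrite (@fsum_additive _ _ (f a _)) //; apply: (actDr bilf).
    rewrite -fsumZ // (@fsum_additive _ _ -%R) //; first exact: opprD.
    by exists L => i /HL ->; rewrite scaler0.
- by exists L => i j lei; rewrite !HL // (act0r bilf) scaler0 subr0 scaler0.
- by move=> i; apply: (right_sum_finsupp bilf trf (bil i) (tr i)).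
Qed.

End SumsOfActions.

Section Twist.

Variables (C : numFieldType) (V : vertexAlgebra C) (h : V) (c : C).
Hypothesis h0 : forall a, nprod h 0 a = 0.

Let nbil := nprod_bilinear V.

(* The coefficients of [c * log (1 + z)]. *)
Definition twist_coef (i : nat) : C := c * (-1) ^+ i.+1 / i%:R.

(** Division by zero yields 0, so sums over [i > 0] may be written from [i = 0]. *)
Lemma twist_coef0 : twist_coef 0 = 0.
Proof. by rewrite /twist_coef invr0 mulr0. Qed.

(** Taylor coefficients of the divided derivative of order [l.+1] of [c * log (1 + z)], which equals
    [twist_coef l.+1] times [(1 + z)^(-l-1)]. *)
Lemma twist_coef_bin l s :
  twist_coef (l.+1 + s) * 'C(l.+1 + s, l.+1)%:R =
  twist_coef l.+1 * binz C (- l.+1%:Z) s.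
Proof.
elim: s => [|s IH]; first by rewrite addn0 binn binz0.
rewrite binzSE mulrA (mulrA (twist_coef l.+1)) -IH.
have ls0 : (l.+1 + s)%:R != 0 :> C by rewrite pnatr_eq0.
have lsS0 : (l.+1 + s.+1)%:R != 0 :> C by rewrite pnatr_eq0.
have s0 : s.+1%:R != 0 :> C by rewrite pnatr_eq0.
have B : (l.+1 + s.+1)%:R * 'C(l.+1 + s, l.+1)%:R =
    s.+1%:R * 'C(l.+1 + s.+1, l.+1)%:R :> C.
  by have := mul_bin_down (l.+1 + s.+1) l.+1; rewrite addKn addnS -!natrM => ->.
have -> : 'C(l.+1 + s.+1, l.+1)%:R =
    (l.+1 + s.+1)%:R * 'C(l.+1 + s, l.+1)%:R / s.+1%:R :> C.
  by rewrite B mulrC mulKf.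
have -> : - l.+1%:Z - s%:Z = - (l.+1 + s)%N%:Z by rewrite PoszD opprD.
rewrite /twist_coef addnS !exprS rmorphN /= -pmulrn -addnS.
move: (l.+1 + s)%:R (l.+1 + s.+1)%:R s.+1%:R 'C(_, _)%:R ls0 lsS0 s0 {B IH}.
by move=> p q r u p0 q0 r0; field; rewrite p0 q0 r0.
Qed.

Section Derivation.

Variable M : lmodType C.
Variable f : V -> int -> M -> M.
Hypotheses (bil : bilinear_modes f) (tr : truncated_modes f).

(** Up to [twist_coef i], the coefficient of [z^(-q-1)] in [z^(-i) Y(h_(i) a, z)]. *)
Definition twist_term (i : nat) (a : V) (q : int) (w : M) : M :=
  twist_coef i *: f (nprod h i%:Z a) (q - i%:Z) w.

Definition twist_derivation (a : V) (q : int) (w : M) : M :=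
  fsum (fun i => twist_term i a q w).

Lemma twist_term_bilinear i : bilinear_modes (twist_term i).
Proof.
rewrite /twist_term; split=> [n w d a b|a n d u w].
  by rewrite nbil.2 bil.1 scalerDr !scalerA mulrC.
by rewrite bil.2 scalerDr !scalerA mulrC.
Qed.

Lemma twist_term_truncated i : truncated_modes (twist_term i).
Proof.
move=> a w; have [N HN] := tr (nprod h i%:Z a) w; exists (N + i%:Z) => n le.
by rewrite /twist_term HN ?scaler0 //; lia.
Qed.

Lemma twist_term_vanishes a :
  exists L, forall i q w, (L <= i)%N -> twist_term i a q w = 0.
Proof.
have [L HL] := nprod_finsupp h a 0; exists L => i q w /HL; rewrite add0r /twist_term.
by move=> ->; rewrite (act0l bil) scaler0.
Qed.

Lemma twist_derivation_bilinear : bilinear_modes twist_derivation.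
Proof.
have fin a n w : finsupp (fun i => twist_term i a n w).
  by have [L HL] := twist_term_vanishes a; exists L => i /HL.
split=> [n w d a b|a n d u w]; rewrite /twist_derivation.
  rewrite -fsumZ // -fsumD; [|exact: finsuppZ|exact: fin].
  by apply: fsum_ext => i; rewrite (twist_term_bilinear i).1.
rewrite -fsumZ // -fsumD; [|exact: finsuppZ|exact: fin].
by apply: fsum_ext => i; rewrite (twist_term_bilinear i).2.
Qed.

Lemma fsum_truncated (F : nat -> V -> int -> M -> M) :
  (forall i, truncated_modes (F i)) ->
  (forall a, exists L, forall i q w, (L <= i)%N -> F i a q w = 0) ->
  truncated_modes (fun a q w => fsum (fun i => F i a q w)).
Proof.
move=> trF fin a w; have [L HL] := fin a.
have [||N HN] := @uniform_bound (fun i N => forall n : int, N%:Z <= n -> F i a n w = 0) L.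
- by move=> l K N le H n leN; apply: H; lia.
- by move=> i; apply: act_vanishes.
exists N%:Z => n le; apply: fsum0 => i.
by have [/HL|/HN] := leqP L i; apply.
Qed.

Lemma twist_derivation_truncated : truncated_modes twist_derivation.
Proof. exact: fsum_truncated twist_term_truncated twist_term_vanishes. Qed.

(* [h_i] acts on [a_(n+j) b] by the commutator formula; collecting the terms
   [(h_l a)_(n+p) b] leaves the Vandermonde sum [binz (- l) s * binz m (p - s)]. *)
Lemma left_sum_derivation a b m n k w :
  left_sum twist_derivation a b m n k w =
  fsum (fun l => twist_coef l *: left_sum f (nprod h l%:Z a) b (m - l%:Z) n k w) +
  fsum (fun l => twist_coef l *: left_sum f a (nprod h l%:Z b) m n (k - l%:Z) w).
Proof.
pose A l p := f (nprod (nprod h l%:Z a) (n + p%:Z) b) (m - l%:Z + k - p%:Z) w.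
pose B i j := f (nprod a (n + j%:Z) (nprod h i%:Z b)) (m + (k - i%:Z) - j%:Z) w.
have [NA HA] : exists N, forall l p, (N <= l)%N || (N <= p)%N -> A l p = 0.
  apply: finsupp2_bound.
    have [L HL] := nprod_finsupp h a 0; exists L => l p /HL; rewrite add0r /A => ->.
    by rewrite (act0l nbil) (act0l bil).
  move=> l; have [L HL] := nprod_finsupp (nprod h l%:Z a) b n; exists L => p /HL.
  by rewrite /A => ->; rewrite (act0l bil).
have [NB HB] : exists N, forall i j, (N <= i)%N || (N <= j)%N -> B i j = 0.
  apply: finsupp2_bound.
    have [L HL] := nprod_finsupp h b 0; exists L => l p /HL; rewrite add0r /B => ->.
    by rewrite (act0r nbil) (act0l bil).
  move=> i; have [L HL] := nprod_finsupp a (nprod h i%:Z b) n; exists L => p /HL.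
  by rewrite /B => ->; rewrite (act0l bil).
(* Here [p = j + (i - l)]. The guard excludes truncated subtraction; the excluded terms carry the
   factor ['C(i, l) = 0]. *)
pose t j i l := if (l <= i)%N then
  (binz C m j * twist_coef i * 'C(i, l)%:R) *: A l (j + (i - l))%N else 0.
have Ht j i l : [|| (NA + NA <= j)%N, (NA + NA <= i)%N | (NA + NA <= l)%N] -> t j i l = 0.
  rewrite /t; case: (leqP l i) => // leli H; rewrite HA ?scaler0 //; lia.
have E j i : f (nprod h i%:Z (nprod a (n + j%:Z) b)) (m + k - j%:Z - i%:Z) w =
    fsum (fun l => 'C(i, l)%:R *: (if (l <= i)%N then A l (j + (i - l))%N else 0))
    + B i j.
  rewrite -[nprod h _ _](subrK (nprod a (n + j%:Z) (nprod h i%:Z b))).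
  rewrite (actDl bil) nprod_commutator; congr (_ + _); last by congr (f _ _ _); lia.
  rewrite (@fsum_additive _ _ (fun u => f u _ w)); first last.
  - by exists i.+1 => l lt; rewrite binz_small // scale0r.
  - by move=> u v; rewrite (actDl bil).
  apply: fsum_ext => l; rewrite (actZl bil) binz_bin; case: leqP => leli; last first.
    by rewrite bin_small // !scale0r.
  by congr (_ *: _); rewrite /A; congr (f (nprod _ _ _) _ _); lia.
transitivity (fsum (fun j => fsum (fun i => fsum (fun l => t j i l)) +
    fsum (fun i => twist_coef i *: (binz C m j *: B i j)))).
  apply: fsum_ext => j; rewrite /twist_derivation /twist_term -fsumZ; last first.
    have [L HL] := twist_term_vanishes (nprod a (n + j%:Z) b).
    by exists L => i /HL; apply.
  rewrite -fsumD; first last.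
  - by exists NB => i le; rewrite HB ?le // !scaler0.
  - by exists (NA + NA)%N => i le; apply: fsum0 => l; rewrite Ht // le orbT.
  apply: fsum_ext => i; rewrite E !scalerDr; congr (_ + _).
    rewrite -!fsumZ; first last.
    + by exists i.+1 => l lt; rewrite bin_small // scale0r.
    + by exists i.+1 => l lt; rewrite bin_small // scale0r scaler0.
    apply: fsum_ext => l; rewrite /t; case: leqP => _; last by rewrite !scaler0.
    by rewrite !scalerA.
  by rewrite !scalerA mulrC.
rewrite fsumD; first last.
- by exists NB => j le; apply: fsum0 => i; rewrite HB ?le ?orbT // !scaler0.
- by exists (NA + NA)%N => j le; apply: fsum0 => i; apply: fsum0 => l; rewrite Ht // le.
congr (_ + _).
  transitivity (fsum (fun l => fsum (fun j => fsum (fun i => t j i l)))).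
    rewrite [RHS]fsum_exchange; first last.
    - by move=> l; exists (NA + NA)%N => j le; apply: fsum0 => i; rewrite Ht // le.
    - exists (NA + NA)%N => l j le; apply: fsum0 => i.
      by rewrite Ht // le !orbT.
    apply: fsum_ext => j; rewrite fsum_exchange //.
      by exists (NA + NA)%N => i l le; rewrite Ht // le orbT.
    by move=> i; exists (NA + NA)%N => l le; rewrite Ht // le orbT ?orbT.
  apply: fsum_ext => -[|l].
    (* The coefficients with [l = 0] on the left need not vanish; these terms disappear because
       [h_(0) a = 0]. *)
    rewrite twist_coef0 scale0r; apply: fsum0 => j; apply: fsum0 => i; rewrite /t /=.
    by rewrite /A h0 (act0l nbil) (act0l bil) scaler0.
  pose F j s := (binz C m j * (twist_coef l.+1 * binz C (- l.+1%:Z) s)) *: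
    A l.+1 (j + s)%N.
  transitivity (fsum (fun j => fsum (F j))).
    apply: fsum_ext => j; rewrite (@fsum_shift _ _ l.+1).
      apply: fsum_ext => s; rewrite /t /F leq_addr addKn -twist_coef_bin.
      by rewrite !mulrA.
    by move=> i lt; rewrite /t leqNgt lt.
  rewrite fsum_antidiagonal; last first.
    by exists NA => j s le; rewrite /F HA ?le ?orbT ?scaler0.
  rewrite /left_sum -fsumZ; last exact: (left_sum_finsupp bil).
  apply: fsum_ext => p; rewrite scalerA -/(A l.+1 p).
  rewrite [m - _]addrC -binz_Vandermonde mulr_sumr scaler_suml.
  apply: eq_bigr => -[s /= ltsp] _; rewrite /F subnK -1?ltnS //.
  by congr (_ *: _); rewrite [LHS]mulrC -mulrA.
rewrite -fsum_exchange; first last.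
- move=> i; exists NB => j le; rewrite HB ?le ?orbT // !scaler0 //.
- by exists NB => i j le; rewrite HB ?le // !scaler0.
apply: fsum_ext => i; rewrite fsumZ //.
by exists NB => j le; rewrite HB ?le ?orbT // scaler0.
Qed.

End Derivation.

Section TwistedModule.

Variable M : vaModule V.
Hypothesis h_nilpotent :
  forall a, exists d, annihilation_filtration h (fun b => b = 0) d a.

(* The component of degree [r] in [c] of [a |-> Y(exp(theta(z)) a, z)], where
   [theta(z) = sum_(i > 0) twist_coef i z^(-i) h_(i)] (Li's deformation). *)
Fixpoint twist_part (r : nat) : V -> int -> M -> M :=
  if r is r'.+1 then
    fun a q w => r'.+1%:R^-1 *: twist_derivation (twist_part r') a q w
  else @mact C V M.

Lemma twist_part_bilinear r : bilinear_modes (twist_part r).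
Proof.
elim: r => [|r IH]; first exact: mact_bilinear.
have [H1 H2] := twist_derivation_bilinear IH; split=> [n w d a b|a n d u w] /=.
  by rewrite H1 scalerDr !scalerA mulrC.
by rewrite H2 scalerDr !scalerA mulrC.
Qed.

Lemma twist_part_truncated r : truncated_modes (twist_part r).
Proof.
elim: r => [|r IH]; first exact: mact_truncated.
have tr := twist_derivation_truncated (twist_part_bilinear r) IH.
move=> a w; have [N HN] := tr a w; exists N => n /HN /= ->.
by rewrite scaler0.
Qed.

(** The part of degree [r] applies [r] modes [h_(i)], [i > 0], to [a], so local nilpotency bounds
    [r]. *)
Lemma twist_part_vanishes a :
  exists R, forall r q w, (R <= r)%N -> twist_part r a q w = 0.
Proof.
have [d Fa] := h_nilpotent a; exists d => r q w.
elim: d r a Fa q w => [|d IH] r a /= Fa q w.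
  by rewrite Fa (act0l (twist_part_bilinear r)).
case: r => // r ler /=; rewrite /twist_derivation fsum0 ?scaler0 // => -[|i].
  by rewrite /twist_term twist_coef0 scale0r.
by rewrite /twist_term (IH r _ (Fa i)) ?scaler0.
Qed.

(** The Leibniz rule for divided powers: [left_sum_derivation] differentiates [a] and [b] in turn,
    and the two sums recombine because [s + (r.+1 - s) = r.+1]. *)
Lemma twist_part_borcherds r a b m n k w :
  left_sum (twist_part r) a b m n k w =
  \sum_(s < r.+1) right_sum (twist_part s) (twist_part (r - s)) a b m n k w.
Proof.
have bil := twist_part_bilinear; have tr := twist_part_truncated.
elim: r a b m n k w => [|r IH] a b m n k w.
  by rewrite big_ord1 /= mact_borcherdsE.
apply: (scalerI (a := r.+1%:R)); first by rewrite pnatr_eq0.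
pose R s t a b m k := right_sum (twist_part s) (twist_part t) a b m n k w.
have Rl s t : s.+1%:R *: R s.+1 t a b m k =
    fsum (fun l => twist_coef l *: R s t (nprod h l%:Z a) b (m - l%:Z) k).
  rewrite /R /= (right_sumZl (twist_derivation_bilinear (bil s)) (bil t)
    (twist_derivation_truncated (bil s) (tr s)) (tr t)).
  rewrite scalerA divff ?pnatr_eq0 // scale1r.
  rewrite (right_sum_fsuml (bil t) (tr t)) //.
  - apply: fsum_ext => l; rewrite -(right_sumZl (bil s) (bil t) (tr s) (tr t)).
    apply: fsum_ext => j; rewrite /twist_term; congr (_ *: (_ *: twist_part s _ _ _ - _)).
      by lia.
    by congr (_ *: (twist_part t _ _ (_ *: twist_part s _ _ _))); lia.
  - by move=> i; apply: twist_term_bilinear.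
  - by move=> i; apply: twist_term_truncated.
  - by have [L HL] := twist_term_vanishes (bil s) a; exists L => i q u /HL.
have Rr s t : t.+1%:R *: R s t.+1 a b m k =
    fsum (fun l => twist_coef l *: R s t a (nprod h l%:Z b) m (k - l%:Z)).
  rewrite /R /= (right_sumZr (bil s) (twist_derivation_bilinear (bil t))
    (tr s) (twist_derivation_truncated (bil t) (tr t))).
  rewrite scalerA divff ?pnatr_eq0 // scale1r.
  rewrite (right_sum_fsumr (bil s) (tr s)) //.
  - apply: fsum_ext => l; rewrite -(right_sumZr (bil s) (bil t) (tr s) (tr t)).
    apply: fsum_ext => j; rewrite /twist_term.
    by congr (_ *: (twist_part s _ _ (_ *: twist_part t _ _ _) -
      _ *: (_ *: twist_part t _ _ _))); lia.
  - by move=> i; apply: twist_term_bilinear.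
  - by move=> i; apply: twist_term_truncated.
  - by have [L HL] := twist_term_vanishes (bil t) b; exists L => i q u /HL.
transitivity (\sum_(s < r.+1) s.+1%:R *: R s.+1 (r - s)%N a b m k +
   \sum_(s < r.+1) (r - s).+1%:R *: R s (r - s).+1 a b m k).
  have -> : r.+1%:R *: left_sum (twist_part r.+1) a b m n k w =
      left_sum (twist_derivation (twist_part r)) a b m n k w.
    rewrite /= (left_sumZ _ _ _ _ _ _ _ (twist_derivation_bilinear (bil r))).
    by rewrite scalerA divff ?pnatr_eq0 // scale1r.
  rewrite (left_sum_derivation (bil r)); congr (_ + _).
    under [RHS]eq_bigr => s _ do rewrite Rl.
    rewrite -(@fsum_sum _ _ (fun s l =>
      twist_coef l *: R s (r - s)%N (nprod h l%:Z a) b (m - l%:Z) k)) => [|s].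
      by apply: fsum_ext => l; rewrite IH scaler_sumr.
    have [L HL] := nprod_finsupp h a 0; exists L => l /HL; rewrite add0r /R => ->.
    by rewrite (right_sum0l (bil _)) ?scaler0 // => *; apply: (act0l (bil _)).
  under [RHS]eq_bigr => s _ do rewrite Rr.
  rewrite -(@fsum_sum _ _ (fun s l =>
    twist_coef l *: R s (r - s)%N a (nprod h l%:Z b) m (k - l%:Z))) => [|s].
    by apply: fsum_ext => l; rewrite IH scaler_sumr.
  have [L HL] := nprod_finsupp h b 0; exists L => l /HL; rewrite add0r /R => ->.
  by rewrite (right_sum0r (bil _)) ?scaler0 // => *; apply: (act0l (bil _)).
rewrite scaler_sumr.
transitivity (\sum_(s < r.+2) s%:R *: R s (r.+1 - s)%N a b m k +
   \sum_(s < r.+2) (r.+1 - s)%N%:R *: R s (r.+1 - s)%N a b m k).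
  rewrite [X in _ = X + _]big_ord_recl /= scale0r add0r; congr (_ + _).
  rewrite [RHS]big_ord_recr /= subnn scale0r addr0.
  by apply: eq_bigr => -[s /= lts] _; rewrite subSn -1?ltnS.
rewrite -big_split; apply: eq_bigr => -[s /= lts] _; rewrite -scalerDl -natrD.
by rewrite subnKC -1?ltnS.
Qed.

Definition twist (a : V) (q : int) (w : M) : M := fsum (fun r => twist_part r a q w).

Lemma twist_bilinear : bilinear_modes twist.
Proof.
have fin a n w : finsupp (fun r => twist_part r a n w).
  by have [L HL] := twist_part_vanishes a; exists L => i /HL.
split=> [n w d a b|a n d u w]; rewrite /twist.
  rewrite -fsumZ // -fsumD; [|exact: finsuppZ|exact: fin].
  by apply: fsum_ext => r; rewrite (twist_part_bilinear r).1.
rewrite -fsumZ // -fsumD; [|exact: finsuppZ|exact: fin].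
by apply: fsum_ext => r; rewrite (twist_part_bilinear r).2.
Qed.

Lemma twist_truncated : truncated_modes twist.
Proof. exact: fsum_truncated twist_part_truncated twist_part_vanishes. Qed.

Lemma twist_borcherds : borcherds (@nprod C V) twist.
Proof.
have bil := twist_part_bilinear; have tr := twist_part_truncated.
apply/(borcherdsP twist_bilinear twist_truncated) => a b m n k w.
rewrite (@left_sum_fsum _ _ _ twist_part) //; last exact: twist_part_vanishes.
rewrite [RHS](@right_sum_fsumr _ _ _ _ twist_bilinear twist_truncated twist_part) //.
  2: exact: twist_part_vanishes.
have [Ra Ha] := twist_part_vanishes a; have [Rb Hb] := twist_part_vanishes b.
transitivity (fsum (fun t => fsum (fun s =>
    right_sum (twist_part s) (twist_part t) a b m n k w))).
  rewrite fsum_antidiagonal.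
    by apply: fsum_ext => r; rewrite twist_part_borcherds.
  exists (Ra + Rb)%N => t s le; have [leR|ltR] := leqP Rb t.
    by rewrite (right_sum0r (bil s)) // => q u; apply: Hb.
  by rewrite (right_sum0l (bil t)) // => q u; apply: Ha; lia.
apply: fsum_ext => t; rewrite [RHS](right_sum_fsuml (bil t) (tr t) (F := twist_part)) //.
by exists Ra.
Qed.

Lemma twist_vac n w : twist (vac V) n w = if n == -1 then w else 0.
Proof.
rewrite /twist fsum1 /=; first exact: mact_vac.
suff H r q u : twist_part r.+1 (vac V) q u = 0 by case.
rewrite /= /twist_derivation fsum0 ?scaler0 // => i; rewrite /twist_term nprod_vacr0.
by rewrite (act0l (twist_part_bilinear r)) scaler0.
Qed.

Definition twisted_module : vaModule V :=
  VaModule twist_bilinear twist_truncated twist_vac twist_borcherds.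

(* The twist moves the eigenvalues of [h_(0)] by [c * kappa]. *)
Lemma twist_h (kappa : C) : ope h h [:: 0; kappa *: vac V] ->
  forall n w, twist h n w = mact h n w + if n == 0 then (c * kappa) *: w else 0.
Proof.
move=> ope_h n w; have bil := twist_part_bilinear.
(* Only [h_(1) h = kappa *: vac V] contributes, with [twist_coef 1 = c]. The next degree
   differentiates the vacuum and gives zero. *)
have part1 (r : nat) q u : twist_part r.+1 h q u =
    (r.+1%:R^-1 * c * kappa) *: twist_part r (vac V) (q - 1) u.
  rewrite /= /twist_derivation (@fsum_single _ _ 1).
    rewrite /twist_term ope_h /= (actZl (bil r)) !scalerA; congr (_ *: _).
    by rewrite /twist_coef sqrrN expr1n divr1 !mulr1 ?mulrA.
  move=> j j1; rewrite /twist_term ope_h; case: j j1 => [|[|j]] //= _; last rewrite nth_nil.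
    by rewrite (act0l (bil r)) scaler0.
  by rewrite (act0l (bil r)) scaler0.
rewrite /twist (@fsumE _ _ 2); last first.
  case=> [|[|r]] // _; rewrite part1 /= /twist_derivation fsum0 ?scaler0 // => i.
  by rewrite /twist_term nprod_vacr0 (act0l (bil r)) scaler0.
rewrite big_ord_recl big_ord1 part1 /= mact_vac; congr (_ + _).
have -> : (n - 1 == -1) = (n == 0) by apply/eqP/eqP; lia.
by case: eqP => _; rewrite ?scaler0 // invr1 mul1r.
Qed.

End TwistedModule.

End Twist.

(** * Modules of the simple quotient *)

Section SimpleQuotient.

Variables (C : numFieldType) (W S : vertexAlgebra C) (X : bpFields W) (pi : W -> S).
Hypotheses (bpX : bp_algebra (-1) X) (quot : simple_quotient pi).

Let hom_pi : va_hom pi. Proof. by case: quot. Qed.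
Let surj_pi : forall s, exists a, pi a = s. Proof. by case: quot. Qed.
Let simpleS : va_simple S. Proof. by case: quot. Qed.
Let opes : bp_opes (-1) X := proj1 bpX.
Let gen_W := proj2 bpX.
Let XS := image_fields pi X.
Let bpS : bp_algebra (-1) XS := image_bp_algebra hom_pi surj_pi bpX.
Local Notation tau := (nprod (fGp X) 0 (fGm X)).

Let pi_vac : pi (vac W) = vac S. Proof. by case: hom_pi. Qed.

Lemma vac_neq0 : vac S <> 0.
Proof.
move=> vac0; have [[a]] := simpleS; case.
by rewrite -[a]nprod_vacr vac0 (act0r (nprod_bilinear S)).
Qed.

Lemma adjoint_submodule_trivial (P : S -> Prop) :
  @submodule C S (adjoint_module S) P -> (forall a, P a -> a = 0) \/ (forall a, P a).
Proof.
by move=> /(submodule_adjoint_ideal (proj1 bpS) (proj2 bpS)); apply: (proj2 simpleS).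
Qed.

(* As a [W]-module the simple quotient is [L(0,0)], and [h1 0 0 = 0]. *)
Lemma quotient_G0 : pi (fGp X) = 0 /\ pi (fGm X) = 0.
Proof.
pose M := pullback_module hom_pi (adjoint_module S).
have irr : irreducible M.
  split; first by exists (vac S); exact: vac_neq0.
  move=> P [sP actP]; apply: adjoint_submodule_trivial; split=> // s n w Pw.
  by have [a <-] := surj_pi s; apply: (actP a n w Pw).
have vacE (a : W) (n : int) : 0 <= n -> mact a n (vac S : M) = 0.
  by move=> n0; rewrite (_ : n = `|n|%N%:Z) ?nprod_vacr0 //; [exact: nprod_vacr0 | lia].
have hw : highest_weight_vector (M := M) X 0 0 (vac S).
  split; [exact: vac_neq0 | | |].
  - by rewrite /Jmode vacE // scale0r.
  - by rewrite /Lmode !vacE // scaler0 subr0 scale0r.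
  - by move=> n n1; rewrite /Jmode /Lmode /Gpmode /Gmmode !vacE ?scaler0 ?subr0 //; lia.
have h00 : h1 0 0 = 0 :> C by rewrite /h1; ring.
have [] := hw_G_vanish opes gen_W irr hw h00 (-1).
by rewrite /= /pullback_act /= !nprod_vacr.
Qed.

Lemma quotient_tau0 : pi tau = 0.
Proof.
case: hom_pi => _ _ ->; rewrite (proj1 quotient_G0).
exact: (act0l (nprod_bilinear S)).
Qed.

Lemma factors_through_h1 (M : vaModule W) x y (v : M) :
  highest_weight_vector X x y v -> factors_through pi M -> h1 x y = 0.
Proof.
move=> hw [act [bil _ _ _ actE]].
have : mact tau 1 v = 0 by rewrite actE quotient_tau0 (act0l bil).
rewrite (hw_tau opes hw) // => /eqP; rewrite scaler_eq0 oppr_eq0.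
by case/orP=> /eqP // v0; case: hw.
Qed.

(** By [ideal_maximal] it is enough that the annihilator of [M] lies in the kernel of [pi]. Its
    image in the simple [S] is zero or everything; in the latter case some [b] annihilating [M] maps
    to the vacuum, which [proper_ideals_comaximal] excludes. *)
Lemma h1_factors_through (M : vaModule W) x y :
  is_L X M x y -> h1 x y = 0 -> factors_through pi M.
Proof.
move=> [irr [v [hw gen]]] h0; apply: factors_through_kernel => //.
have v0 : v <> 0 by case: hw.
have G0 := hw_G_vanish opes gen_W irr hw h0.
have idA := annihilates_ideal M.
have AGp : annihilates M (fGp X).
  by apply: (generated_annihilates gen) => n; case: (G0 n).
have AGm : annihilates M (fGm X).
  by apply: (generated_annihilates gen) => n; case: (G0 n).
have nA : ~ annihilates M (vac W).
  by move=> /(_ (-1) v); rewrite mact_vac.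
have nK : pi (vac W) <> 0 by rewrite pi_vac; exact: vac_neq0.
have idK := kernel_ideal hom_pi.
apply: (ideal_maximal opes gen_W idA AGp AGm idK) => // a Aa.
have [] := proj2 simpleS _ (image_ideal hom_pi surj_pi idA).
  by apply; exists a.
move=> /(_ (vac S)) [b Ab pib].
case: (proper_ideals_comaximal opes gen_W idA idK nA nK Ab).
by rewrite (va_homD hom_pi) (va_homN hom_pi) pi_vac pib subrr.
Qed.

Let zero_ideal : va_ideal (fun s : S => s = 0).
Proof.
split; first exact: subspace_zero.
by move=> a u n ->; rewrite (act0r (nprod_bilinear S)) (act0l (nprod_bilinear S)).
Qed.

Let Gp0 : fGp XS = 0. Proof. exact: (proj1 quotient_G0). Qed.
Let Gm0 : fGm XS = 0. Proof. exact: (proj2 quotient_G0). Qed.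

Lemma exists_highest_weight_module x y : h1 x y = 0 ->
  exists M : vaModule W, is_L X M x y.
Proof.
move=> h0; have [opesS genS] := bpS.
have J0 := ideal_J0 opesS genS zero_ideal Gp0 Gm0.
have nilJ := J_filtration_exhausts opesS genS zero_ideal Gp0 Gm0.
(* At level -1, [J_(1) J = (1/3) vac], so [c = 3 * x] shifts [J_(0)] by [x]. *)
pose N := twisted_module (3 * x) J0 (adjoint_module S) nilJ.
have bilN := mact_bilinear N.
have JE (n : int) (w : S) :
    mact (fJ XS) n (w : N) = nprod (fJ XS) n w + if n == 0 then x *: w else 0.
  rewrite /= (twist_h (M := adjoint_module S) (3 * x) (ope_JJ opesS)) /=; case: eqP => // _.
  by congr (_ + _ *: _); field.
(* Twisted and original modes of [J] differ by scalars, so a submodule of the twist is stable under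
   the original [J], hence under all of [S], which is simple. *)
have irr (P : S -> Prop) : @submodule C S N P ->
    (forall a, P a -> a = 0) \/ (forall a, P a).
  move=> [sP actP]; apply: adjoint_submodule_trivial; split=> // a.
  apply: (J_induction opesS genS zero_ideal Gp0 Gm0
    (P := fun a => forall n w, P w -> P (nprod a n w))).
  - split=> [n w _|c u v Pu Pv n w Pw].
      by rewrite (act0l (nprod_bilinear S)); apply: subspace0.
    by rewrite (nprod_bilinear S).1; apply: sP.2; [apply: Pu | apply: Pv].
  - by move=> u -> n w _; rewrite (act0l (nprod_bilinear S)); apply: subspace0.
  - by move=> n w Pw; rewrite nprod_vacl; case: eqP => // _; apply: subspace0.
  - move=> m u Pu n w Pw.
    have PJ q t : P t -> P (nprod (fJ XS) q t).
      move=> Pt; have := actP (fJ XS) q t Pt; rewrite JE; apply: subspaceDE => //.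
      by case: eqP => _; [apply: subspaceZ | apply: subspace0].
    by apply: nprod_iterate_closed => // j; [apply/PJ/Pu | apply/Pu/PJ].
pose M := pullback_module hom_pi N.
have irrM (P : M -> Prop) : submodule P -> (forall a, P a -> a = 0) \/ (forall a, P a).
  move=> [sP actP]; apply: irr; split=> // s n w Pw.
  by have [a <-] := surj_pi s; apply: (actP a n w Pw).
exists M; split.
  by split=> //; exists (vac S); exact: vac_neq0.
exists (vac S); split; last first.
  by move=> P /irrM [] // P0 /P0 /vac_neq0.
have HJ (n : int) : 0 < n -> mact (fJ XS) n (vac S : N) = 0.
  move=> n0; rewrite JE (_ : (n == 0) = false) ?addr0; last by apply/eqP; lia.
  by rewrite (_ : n = `|n|%N%:Z) ?nprod_vacr0 //; lia.
have HJ0 : mact (fJ XS) 0 (vac S : N) = x *: (vac S : N).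
  by rewrite JE (nprod_vacr0 0) add0r.
have HT (n : int) : 0 < n -> mact (fT XS) n (vac S : N) =
    if n == 1 then (3 / 2 * x ^+ 2) *: (vac S : N) else 0.
  move=> n0; rewrite (TE opesS) Gp0 (act0l (nprod_bilinear S)) scaler0 subr0.
  rewrite (actZl bilN) (mact_JJ HJ HJ0) //.
  by case: eqP => _; rewrite ?scalerA ?scaler0.
split; [exact: vac_neq0 | exact: HJ0 | |].
- rewrite /Lmode /= /pullback_act [X in X - _]HT // [X in _ - _ *: X]HJ0 scalerA -scalerBl.
  (* The Sugawara eigenvalue [3 / 2 * x ^+ 2] minus [x / 2] equals [y] exactly when [h1 x y = 0]. *)
  congr (_ *: _); rewrite -[_%:~R]/(1 : C).
  apply: (@mulfI _ 2); first by rewrite pnatr_eq0.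
  by apply/eqP; rewrite eq_sym -subr_eq0 -h0 /h1; apply/eqP; field.
- move=> n n1; split.
  + by apply: HJ; lia.
  + rewrite /Lmode /= /pullback_act [X in X - _]HT ?[X in _ - _ *: X]HJ; try by lia.
    by rewrite scaler0 subr0; case: eqP => //; lia.
  + rewrite /Gpmode /= /pullback_act (proj1 quotient_G0); exact: (act0l bilN).
  + rewrite /Gmmode /= /pullback_act (proj2 quotient_G0); exact: (act0l bilN).
Qed.

End SimpleQuotient.

Theorem theorem8p4 (R : realType) (W S : vertexAlgebra R[i])
    (X : bpFields W) (pi : W -> S)
    (universalW : universal_bp (-1) X) (simpleS : simple_quotient pi) :
  (forall M : vaModule W,
     (exists x y : R[i], S_minus1 x y /\ is_L X M x y)
     <-> irreducible_in_O pi X M)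
  /\ (forall x y : R[i], S_minus1 x y -> exists M : vaModule W, is_L X M x y).
Proof.
have [bpX _] := universalW.
split=> [M|x y h0]; last exact: (exists_highest_weight_module bpX simpleS h0).
split=> [[x [y [h0 LM]]]|[[x [y LM]] factM]].
  by split; [exists x, y | exact: (h1_factors_through bpX simpleS LM h0)].
exists x, y; split=> //; have [_ [v [hw _]]] := LM.
exact: (factors_through_h1 bpX simpleS hw factM).
Qed.
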